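(* Let $\mathcal{T}$ be the Toeplitz algebra, realized as a graph $C^*$-algebra and equipped with the restriction of the gauge action to $\mathbb{Z}/2$. Then $\mathrm{dim}^{\mathbb{Z}/2}_{\mathrm{WLT}}(\mathcal{T})=1$.
   Context: $\mathcal{T}=C^*(V\mid V^*V=1)$ is the universal $C^*$-algebra generated by an isometry. It is realized as the graph $C^*$-algebra of the graph with two vertices $v_1,v_2$, a loop at $v_1$, and one edge from $v_1$ to $v_2$. For a finite directed graph $E=(E^0,E^1,r,s)$, $C^*(E)$ is the universal $C^*$-algebra generated by mutually orthogonal projections $P_v$ ($v\in E^0$) and partial isometries $S_e$ ($e\in E^1$) with mutually orthogonal ranges such that $S_e^*S_e=P_{r(e)}$, $S_eS_e^*\le P_{s(e)}$, and $P_v=\sum_{e\in s^{-1}(v)}S_eS_e^*$ whenever $s^{-1}(v)$ is nonempty. The gauge action of $\mathbb{S}^1$ is $S_e\mapsto\lambda S_e$, $P_v\mapsto P_v$ (under the identification with the Toeplitz algebra, $V$ is the sum of the two edge partial isometries, so the $\mathbb{Z}/2$-action is $V\mapsto-V$). Weak local-triviality dimension: let a compact group $G$ act on a unital $C^*$-algebra $A$. Equip $C(G)$ with $(\alpha_gf)(h)=f(hg)$ and $C_0((0,1])\otimes C(G)$ with the action on the second factor, and let $t$ be the identity function in $C_0((0,1])$. $\mathrm{dim}^G_{\mathrm{WLT}}(A)$ is the smallest $m\ge0$ for which there exist $G$-equivariant $*$-homomorphisms $\rho_0,\ldots,\rho_m:C_0((0,1])\otimes C(G)\to A$ such that $\sum_{i=0}^m\rho_i(t\otimes1)$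 is invertible ($\infty$ if no such $m$ exists). *)

(* Defs.v *)
From HB Require Import structures.
From mathcomp Require Import all_boot all_order all_algebra.
From mathcomp Require Import complex.
From mathcomp Require Import all_classical all_reals all_analysis.

Set Implicit Arguments.
Unset Strict Implicit.
Unset Printing Implicit Defensive.

Import Order.TTheory GRing.Theory Num.Theory.
Import numFieldNormedType.Exports.

Local Open Scope classical_set_scope.
Local Open Scope ring_scope.

(* Complex star-algebras are not assumed unital, hence carry their own product
   [smul] rather than a ring structure. The scalars are R[i]; they are written
   R[i]^o where their topology is used. *)
HB.mixin Record Lmodule_isStarAlgebra (R : realType) A of GRing.Lmodule R[i] A := {
  smul : A -> A -> A;
  star : A -> A;
  smulA : associative smul;
  smulDl : left_distributive smul +%R;
  smulDr : right_distributive smul +%R;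
  smulZl : forall (c : R[i]) x y, smul (c *: x) y = c *: smul x y;
  smulZr : forall (c : R[i]) x y, smul x (c *: y) = c *: smul x y;
  starK : involutive star;
  starD : {morph star : x y / x + y};
  starZ : forall (c : R[i]) x, star (c *: x) = c^*%R *: star x;
  starM : forall x y, star (smul x y) = smul (star y) (star x)
}.

#[short(type="starAlgType")]
HB.structure Definition StarAlgebra (R : realType) :=
  {A of GRing.Lmodule R[i] A & Lmodule_isStarAlgebra R A}.

HB.mixin Record StarAlgebra_isCStar (R : realType) A
    of StarAlgebra R A & CompleteNormedModule R[i] A := {
  norm_smul : forall x y : A, `|smul x y| <= `|x| * `|y|;
  norm_star_smul : forall x : A, `|smul (star x) x| = `|x| ^+ 2
}.

#[short(type="cstarType")]
HB.structure Definition CStarAlgebra (R : realType) :=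
  {A of StarAlgebra R A & CompleteNormedModule R[i] A & StarAlgebra_isCStar R A}.

HB.mixin Record StarAlgebra_hasUnit (R : realType) A of StarAlgebra R A := {
  sone : A;
  smul1l : left_id sone (@smul R A);
  smul1r : right_id sone (@smul R A)
}.

#[short(type="unitalCstarType")]
HB.structure Definition UnitalCStarAlgebra (R : realType) :=
  {A of CStarAlgebra R A & StarAlgebra_hasUnit R A}.

(* Groups are written multiplicatively, also the additive group 'Z_2 below. *)
HB.mixin Record Topological_isTopGroup G of Group G & Topological G := {
  mulg_continuous : continuous (fun p : G * G => (p.1 * p.2)%g);
  invg_continuous : continuous (fun x : G => (x^-1)%g)
}.

#[short(type="topGroupType")]
HB.structure Definition TopGroup :=
  {G of Group G & Topological G & Topological_isTopGroup G}.

HB.mixin Record TopGroup_isCompact G of TopGroup G := {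
  compactG : compact [set: G];
  hausdorffG : hausdorff_space G
}.

#[short(type="compactGroupType")]
HB.structure Definition CompactGroup := {G of TopGroup G & TopGroup_isCompact G}.

Definition Z2 : Type := discrete_topology 'Z_2.
HB.instance Definition _ := DiscreteTopology.on Z2.
HB.instance Definition _ := Group.copy Z2 'Z_2.

Lemma Z2_mulg_continuous : continuous (fun p : Z2 * Z2 => (p.1 * p.2)%g).
Proof.
move=> [a b] U /nbhs_singleton Uab /=.
exists ([set a], [set b]) => /=; first by split; exact: discrete_set1.
by move=> [x y] /= [-> ->].
Qed.

Lemma Z2_invg_continuous : continuous (fun x : Z2 => (x^-1)%g).
Proof.
move=> a U /nbhs_singleton Ua /=; apply: (filterS _ (discrete_set1 a)).
by move=> x ->.
Qed.

HB.instance Definition _ :=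
  Topological_isTopGroup.Build Z2 Z2_mulg_continuous Z2_invg_continuous.

Lemma Z2_compact : compact [set: Z2].
Proof. by apply: finite_compact; exact: (@finite_finset 'Z_2 _). Qed.

Lemma Z2_hausdorff : hausdorff_space Z2.
Proof. exact: discrete_hausdorff. Qed.

HB.instance Definition _ := TopGroup_isCompact.Build Z2 Z2_compact Z2_hausdorff.

Definition circle (R : realType) : Type := set_type [set z : R[i]^o | `|z| = 1].
HB.instance Definition _ (R : realType) := Topological.on (circle R).

Section Circle.
Variable R : realType.
Local Notation T := (circle R).
Implicit Types z w : T.

Lemma circleP z : `|\val z| = 1.
Proof. by case: z => z /= /set_mem. Qed.

Lemma circle_neq0 z : \val z != 0.
Proof. by rewrite -normr_gt0 circleP. Qed.

Lemma circle1_subproof : (1 : R[i]^o) \in [set z : R[i]^o | `|z| = 1].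
Proof. by apply/mem_set; rewrite /= normr1. Qed.
Definition circle1 : T := exist _ 1 circle1_subproof.

Lemma circleM_subproof z w : (\val z * \val w : R[i]^o) \in [set z : R[i]^o | `|z| = 1].
Proof. by apply/mem_set; rewrite /= normrM !circleP mulr1. Qed.
Definition circleM z w : T := exist _ (\val z * \val w) (circleM_subproof z w).

Lemma circleV_subproof z : ((\val z)^-1 : R[i]^o) \in [set z : R[i]^o | `|z| = 1].
Proof. by apply/mem_set; rewrite /= normrV ?unitfE ?circle_neq0// circleP invr1. Qed.
Definition circleV z : T := exist _ (\val z)^-1 (circleV_subproof z).

Lemma circle_mulA : associative circleM.
Proof. by move=> x y z; apply: val_inj; rewrite /= mulrA. Qed.
Lemma circle_mul1 : left_id circle1 circleM.
Proof. by move=> x; apply: val_inj; rewrite /= mul1r. Qed.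
Lemma circle_mulr1 : right_id circle1 circleM.
Proof. by move=> x; apply: val_inj; rewrite /= mulr1. Qed.
Lemma circle_mulV : left_inverse circle1 circleV circleM.
Proof. by move=> x; apply: val_inj; rewrite /= mulVf ?circle_neq0. Qed.
Lemma circle_mulrV : right_inverse circle1 circleV circleM.
Proof. by move=> x; apply: val_inj; rewrite /= mulfV ?circle_neq0. Qed.

HB.instance Definition _ := isGroup.Build T circle_mulA circle_mul1
  circle_mulr1 circle_mulV circle_mulrV.

Lemma circle_val_continuous : continuous (fun z : T => \val z : R[i]^o).
Proof. exact: initial_continuous. Qed.

Lemma continuous_to_circle (X : topologicalType) (f : X -> T) :
  continuous (fun x => \val (f x) : R[i]^o) -> continuous f.
Proof. exact: continuous_comp_initial. Qed.

Lemma circle_mulg_continuous : continuous (fun p : T * T => (p.1 * p.2)%g).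
Proof.
apply: continuous_to_circle => p /=.
apply: (@cvgM R[i] _ (nbhs p) _ (fun p : T * T => \val p.1) (fun p : T * T => \val p.2)).
  by apply: continuous_comp; [exact: cvg_fst|exact: circle_val_continuous].
by apply: continuous_comp; [exact: cvg_snd|exact: circle_val_continuous].
Qed.

Lemma circle_invg_continuous : continuous (fun z : T => (z^-1)%g).
Proof.
apply: continuous_to_circle => z /=.
apply: (@cvgV R[i] _ (nbhs z) _ (fun z : T => \val z)); first exact: circle_neq0.
exact: circle_val_continuous.
Qed.

HB.instance Definition _ :=
  Topological_isTopGroup.Build T circle_mulg_continuous circle_invg_continuous.
End Circle.

(* C0 R X is the star-algebra C_0(X) of continuous complex functions vanishing
   at infinity; it is all of C(X) when X is compact. *)
Section C0Set.
Variables (R : realType) (X : topologicalType).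
Local Notation C := (R[i]^o).
Implicit Types f g : X -> C.

Definition C0_set : set (X -> C) := [set f | continuous f /\
  forall e : R[i], 0 < e -> compact [set x | e <= `|f x|]].

Lemma conj_continuous : continuous (fun z : C => z^*%R : C).
Proof.
move=> z U /(@nbhs_ballP R[i] C) [e /= e0 eU].
apply/(@nbhs_ballP R[i] C); exists e => //= y; rewrite -ball_normE /= => zy.
by apply: eU; rewrite -ball_normE /= -rmorphB norm_conjC.
Qed.

Lemma ge_norm_closed f (e : R[i]) : 0 < e -> continuous f ->
  closed [set x | e <= `|f x|].
Proof.
move=> e0 cf; rewrite -openC.
rewrite (_ : ~` _ = f @^-1` ball (0 : C) e).
  apply: open_comp; last exact: (@ball_open R[i] C).
  by move=> x _; exact: cf.
apply/seteqP; split => x /=.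
  move=> /negP; rewrite -real_ltNge ?normr_real ?gtr0_real// => h.
  by rewrite -ball_normE /= sub0r normrN.
rewrite -ball_normE /= sub0r normrN => h; apply/negP.
by rewrite -real_ltNge ?normr_real ?gtr0_real.
Qed.

Lemma C0_le f (A : set X) (e : R[i]) : 0 < e -> continuous f -> compact A ->
  [set x | e <= `|f x|] `<=` A -> compact [set x | e <= `|f x|].
Proof.
by move=> e0 cf cA; apply: subclosed_compact => //; exact: ge_norm_closed.
Qed.

Lemma C0_0 : C0_set 0.
Proof.
split=> [|e e0]; first exact: cst_continuous.
rewrite (_ : mkset _ = set0); first exact: compact0.
by apply/seteqP; split => x //=; rewrite normr0 => /(lt_le_trans e0); rewrite ltxx.
Qed.

Lemma C0_ZD (a : R[i]) f g : C0_set f -> C0_set g -> C0_set (a *: f + g).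
Proof.
move=> [cf f0] [cg g0]; have cfg : continuous (a *: f + g).
  move=> x; apply: (@cvgD R[i] C); last exact: cg.
  by apply: (@cvgZl_tmp R[i] C); exact: cf.
split=> // e e0.
have e20 : 0 < e / 2 by rewrite divr_gt0.
have a0 : 0 < `|a| + 1 by rewrite ltr_wpDl.
apply: (C0_le e0 cfg (compactU (f0 _ (divr_gt0 e20 a0)) (g0 _ e20))) => x /= ex.
have [|ng] := boolP (e / 2 <= `|g x|); [by right|left].
move: ng; rewrite -real_ltNge ?normr_real ?gtr0_real// => ng.
rewrite ler_pdivrMr//.
have : e <= `|a| * `|f x| + `|g x|.
  by rewrite -normrM; apply: (le_trans ex); exact: ler_normD.
rewrite -lerBlDr => h.
apply: (@le_trans _ _ (`|a| * `|f x|)).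
  apply: le_trans h; rewrite lerBrDr; apply: (@le_trans _ _ (e / 2 + e / 2)).
    by rewrite lerD2l ltW.
  by rewrite -splitr.
by rewrite mulrC ler_wpM2l// lerDl.
Qed.

Definition in_C0 : {pred X -> C} := mem C0_set.

Lemma C0_submod_closed : submod_closed in_C0.
Proof.
split=> [|a f g /set_mem hf /set_mem hg]; apply/mem_set; first exact: C0_0.
exact: C0_ZD.
Qed.

Lemma C0_mul f g : C0_set f -> C0_set g -> C0_set (fun x => f x * g x).
Proof.
move=> [cf f0] [cg g0].
have cfg : continuous (fun x => f x * g x : C).
  by move=> x; apply: (@cvgM R[i] _ (nbhs x)); [exact: cf|exact: cg].
split=> // e e0.
apply: (C0_le e0 cfg (compactU (f0 _ e0) (g0 _ ltr01))) => x /=.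
rewrite normrM => ex.
have [|nf] := boolP (e <= `|f x|); [by left|right].
move: nf; rewrite -real_ltNge ?normr_real ?gtr0_real// => nf.
have fx0 : 0 < `|f x|.
  rewrite lt_neqAle normr_ge0 andbT eq_sym; apply/eqP => fx0.
  by move: ex; rewrite fx0 mul0r => /(lt_le_trans e0); rewrite ltxx.
rewrite -(@ler_pM2l _ e)// mulr1; apply: (le_trans ex).
by rewrite ler_wpM2r// ltW.
Qed.

Lemma C0_conj f : C0_set f -> C0_set (fun x => (f x)^*%R).
Proof.
move=> [cf f0]; split=> [|e e0].
  by move=> x; apply: continuous_comp; [exact: cf|exact: conj_continuous].
rewrite (_ : mkset _ = [set x | e <= `|f x|]); first exact: f0.
by apply/seteqP; split => x /=; rewrite norm_conjC.
Qed.

End C0Set.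
Arguments C0_set : clear implicits.
Arguments in_C0 : clear implicits.

Record C0 (R : realType) (X : topologicalType) :=
  MkC0 { C0_fun :> X -> R[i]^o ; C0_subproof : C0_fun \in in_C0 R X }.

HB.instance Definition _ R X := [isSub for @C0_fun R X].
HB.instance Definition _ R X := [Choice of C0 R X by <:].

Section C0Algebra.
Variables (R : realType) (X : topologicalType).
HB.instance Definition _ := GRing.isSubmodClosed.Build R[i] (X -> R[i]^o)
  (in_C0 R X) (@C0_submod_closed R X).
HB.instance Definition _ :=
  [SubChoice_isSubLmodule of C0 R X by <:].

Implicit Types f g h : C0 R X.

Lemma C0P f : C0_set R X f.
Proof. by apply/set_mem; exact: C0_subproof. Qed.

Definition C0_smul f g : C0 R X :=
  MkC0 (mem_set (C0_mul (C0P f) (C0P g))).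

Definition C0_star f : C0 R X := MkC0 (mem_set (C0_conj (C0P f))).

Lemma C0_ext f g : (forall x, f x = g x) -> f = g.
Proof. by move=> fg; apply: val_inj; exact/funext. Qed.

Lemma C0_smulA : associative C0_smul.
Proof. by move=> f g h; apply: C0_ext => x /=; rewrite mulrA. Qed.
Lemma C0_smulDl : left_distributive C0_smul +%R.
Proof. by move=> f g h; apply: C0_ext => x /=; rewrite mulrDl. Qed.
Lemma C0_smulDr : right_distributive C0_smul +%R.
Proof. by move=> f g h; apply: C0_ext => x /=; rewrite mulrDr. Qed.
Lemma C0_smulZl (c : R[i]) f g : C0_smul (c *: f) g = c *: C0_smul f g.
Proof. by apply: C0_ext => x /=; exact: (esym (mulrA _ _ _)). Qed.
Lemma C0_smulZr (c : R[i]) f g : C0_smul f (c *: g) = c *: C0_smul f g.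
Proof. by apply: C0_ext => x /=; exact: mulrCA. Qed.
Lemma C0_starK : involutive C0_star.
Proof. by move=> f; apply: C0_ext => x /=; exact: conjCK. Qed.
Lemma C0_starD : {morph C0_star : f g / f + g}.
Proof. by move=> f g; apply: C0_ext => x /=; exact: rmorphD. Qed.
Lemma C0_starZ (c : R[i]) f : C0_star (c *: f) = c^*%R *: C0_star f.
Proof. by apply: C0_ext => x /=; exact: rmorphM. Qed.
Lemma C0_starM f g : C0_star (C0_smul f g) = C0_smul (C0_star g) (C0_star f).
Proof. by apply: C0_ext => x /=; rewrite rmorphM mulrC. Qed.

HB.instance Definition _ := Lmodule_isStarAlgebra.Build R (C0 R X)
  C0_smulA C0_smulDl C0_smulDr C0_smulZl C0_smulZr
  C0_starK C0_starD C0_starZ C0_starM.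
End C0Algebra.

Section Tensor.
Variable R : realType.

Lemma C0_bounded (X : topologicalType) (f : C0 R X) :
  exists2 M : R[i], 0 < M & forall x, `|f x| < M.
Proof.
have [cf /(_ 1 ltr01)] := C0P f; rewrite compact_near_coveringP => K.
have /K [] : forall x, 1 <= `|f x| -> \forall x' \near x & M \near +oo%R,
    `|f x'| < (M : R)%:C%C.
  move=> x _.
  exists ([set x' | `|f x'| < `|f x| + 1],
          [set M : R | (complex.Re `|f x| + 1 < M)%R]) => /=.
    split; last by apply: nbhs_pinfty_gt; rewrite num_real.
    have ob : open (f @^-1` ball (f x : R[i]^o) (1 : R[i])).
      by apply: open_comp; [move=> y _; exact: cf|exact: (@ball_open R[i] R[i]^o)].
    have nb : nbhs x (f @^-1` ball (f x : R[i]^o) (1 : R[i])).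
      by apply: open_nbhs_nbhs; split => //; exact: (@ballxx R[i] R[i]^o).
    apply: (filterS _ nb) => x' /=; rewrite -ball_normE /= => h.
    rewrite -ltrBlDl; apply: le_lt_trans h.
    by rewrite distrC; exact: lerB_dist.
  move=> [x' M] /= [h1 h2]; apply: (lt_trans h1).
  have -> : `|f x| + 1 = (complex.Re `|f x| + 1)%:C%C.
    rewrite -[X in X + 1](RRe_real (normr_real (f x))).
    by rewrite (rmorphD (real_complex R)) rmorph1.
  by rewrite ltcR.
move=> M [_ KM].
exists (`|M| + 1 + 1)%:C%C => [|x]; first by rewrite ltcR -addrA ltr_wpDl.
have [f1|] := boolP (1 <= `|f x|).
  have M1 : M < `|M| + 1 by rewrite (le_lt_trans (ler_norm M))// ltrDl.
  by apply: (lt_trans (KM _ M1 x f1)); rewrite ltcR ltrDl.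
rewrite -real_ltNge ?normr_real ?real1// => /lt_trans; apply.
by rewrite ltcR ltrDr ltr_wpDl.
Qed.

(* For locally compact Hausdorff X and Y, the tensor product of C_0(X) and
   C_0(Y) is C_0(X * Y), with f (x) g the function (x, y) |-> f x * g y. *)
Lemma C0_tensor_subproof (X Y : topologicalType) (f : C0 R X) (g : C0 R Y) :
  (fun p : X * Y => f p.1 * g p.2 : R[i]^o) \in in_C0 R (X * Y)%type.
Proof.
have [cf f0] := C0P f; have [cg g0] := C0P g.
have [M M0 fM] := C0_bounded f; have [N N0 gN] := C0_bounded g.
have cfg : continuous (fun p : X * Y => f p.1 * g p.2 : R[i]^o).
  move=> p; apply: (@cvgM R[i] _ (nbhs p) _ (f \o fst) (g \o snd)).
    by apply: continuous_comp; [exact: cvg_fst|exact: cf].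
  by apply: continuous_comp; [exact: cvg_snd|exact: cg].
apply/mem_set; split=> // e e0.
apply: (C0_le e0 cfg (compact_setX (f0 _ (divr_gt0 e0 N0)) (g0 _ (divr_gt0 e0 M0)))).
move=> [x y] /=; rewrite normrM => h; split; rewrite ler_pdivrMr//.
  by apply: (le_trans h); rewrite ler_wpM2l// ltW.
by apply: (le_trans h); rewrite mulrC ler_wpM2l// ltW.
Qed.

Definition C0_tensor (X Y : topologicalType) (f : C0 R X) (g : C0 R Y) :
  C0 R (X * Y)%type := MkC0 (C0_tensor_subproof f g).

Lemma C0_one_subproof (G : compactGroupType) :
  (fun _ : G => 1 : R[i]^o) \in in_C0 R G.
Proof.
apply/mem_set; split=> [|e e0]; first exact: cst_continuous.
by apply: (C0_le e0 _ (@compactG G)) => //; exact: cst_continuous.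
Qed.

Definition C0_one (G : compactGroupType) : C0 R G := MkC0 (C0_one_subproof G).

(* The space (0, 1], with identity function [unitIoc_id]. *)
Definition unitIoc : Type := set_type [set x : R | 0 < x <= 1].
HB.instance Definition _ := Topological.on unitIoc.

Lemma real_complex_continuous : continuous (fun x : R => x%:C%C : R[i]^o).
Proof.
move=> x U /(@nbhs_ballP R[i] R[i]^o) [e /= e0 eU].
have eE : e = (complex.Re e)%:C%C by rewrite RRe_real// gtr0_real.
apply/nbhs_ballP; exists (complex.Re e) => /=; first by rewrite -ltcR -eE.
move=> y; rewrite -ball_normE /= => xy; apply: eU; rewrite -ball_normE /=.
by rewrite -rmorphB normc_def /= expr0n addr0 sqrtr_sqr eE ltcR.
Qed.

Lemma unitIoc_segment_compact (e : R) : 0 < e ->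
  compact [set s : unitIoc | e <= \val s].
Proof.
move=> e0 F FF Fe.
have [|x [/= ex clx]] := @segment_compact R e 1 ((\val : unitIoc -> R) @ F) _.
  apply: (@filterS _ F _ _ _ _ Fe) => s /= es; rewrite in_itv /= es /=.
  by case: s es => s /= /set_mem /= /andP[].
have x01 : x \in [set x : R | 0 < x <= 1].
  apply/mem_set; move: ex; rewrite /= in_itv /= => /andP[h ->].
  by rewrite (lt_le_trans e0 h).
exists (exist _ x x01); split.
  by move: ex; rewrite /= in_itv /= => /andP[].
move=> A B FA [_ [[V oV <-] Vx VB]].
have FVA : ((\val : unitIoc -> R) @ F) (\val @` A).
  by apply: (@filterS _ F _ _ _ _ FA) => s As; exists s.
have nV : nbhs x V by exact: open_nbhs_nbhs.
have [y [[s As <-] Vs]] := clx _ _ FVA nV.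
by exists s; split => //; exact: VB.
Qed.

Lemma unitIoc_id_subproof :
  (fun s : unitIoc => (\val s)%:C%C : R[i]^o) \in in_C0 R unitIoc.
Proof.
have ct : continuous (fun s : unitIoc => (\val s)%:C%C : R[i]^o).
  move=> s; apply: continuous_comp; first exact: initial_continuous.
  exact: real_complex_continuous.
apply/mem_set; split=> // e e0.
have eE : e = (complex.Re e)%:C%C by rewrite RRe_real// gtr0_real.
have Re0 : 0 < complex.Re e by rewrite -ltcR -eE.
apply: (C0_le e0 ct (unitIoc_segment_compact Re0)) => s /=.
rewrite normc_def /= expr0n addr0 sqrtr_sqr eE lecR gtr0_norm//.
by case: s => s /= /set_mem /= /andP[].
Qed.

Definition unitIoc_id : C0 R unitIoc := MkC0 unitIoc_id_subproof.

(* The action on C_0(X) (x) C(G) by (alpha_g f)(h) = f (h g) on the second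
   factor. *)
Lemma C0_rtrans_subproof (X : topologicalType) (G : compactGroupType) (g : G)
    (F : C0 R (X * G)%type) :
  (fun p : X * G => F (p.1, (p.2 * g)%g)) \in in_C0 R (X * G)%type.
Proof.
have [cF F0] := C0P F.
have ctr h : continuous (fun p : X * G => (p.1, (p.2 * h)%g) : X * G).
  move=> p; apply: cvg_pair; first exact: cvg_fst.
  apply: (@continuous_comp _ _ _ (fun p : X * G => (p.2, h) : G * G)
     (fun q => (q.1 * q.2)%g)); last exact: mulg_continuous.
  by apply: cvg_pair; [exact: cvg_snd|exact: cvg_cst].
have cFg : continuous (fun p : X * G => F (p.1, (p.2 * g)%g)).
  by move=> p; apply: continuous_comp; [exact: ctr|exact: cF].
apply/mem_set; split=> // e e0.
apply: (C0_le e0 cFg (continuous_compact (continuous_subspaceT (ctr (g^-1)%g)) (F0 _ e0))).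
move=> [x h] /= eF; exists (x, (h * g)%g) => //=.
by rewrite -mulgA mulgV mulg1.
Qed.

Definition C0_rtrans (X : topologicalType) (G : compactGroupType) (g : G)
  (F : C0 R (X * G)%type) : C0 R (X * G)%type := MkC0 (C0_rtrans_subproof g F).
End Tensor.

Notation "x ** y" := (smul x y) (at level 40, left associativity) : ring_scope.

Section StarHom.
Variables (R : realType) (A B : starAlgType R).

Record star_hom (f : A -> B) : Prop := StarHom {
  star_homD : {morph f : x y / x + y};
  star_homZ : forall c : R[i], {morph f : x / c *: x};
  star_homM : {morph f : x y / x ** y};
  star_hom_star : {morph f : x / star x}
}.

End StarHom.

Record cstar_action (G : topGroupType) (R : realType) (A : cstarType R) :=
  CStarAction {
  act :> G -> A -> A;
  act_hom : forall g, star_hom (act g);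
  act1 : forall a, act 1%g a = a;
  actM : forall g h a, act (g * h)%g a = act g (act h a);
  act_continuous : forall a, continuous (fun g => act g a)
}.

(* Restriction of an action of H along a continuous morphism G -> H. *)
Section RestrictAction.
Variables (G H : topGroupType) (R : realType) (A : cstarType R).
Variables (phi : G -> H) (phi1 : phi 1%g = 1%g).
Hypothesis phiM : {morph phi : g h / (g * h)%g}.
Hypothesis phi_cont : continuous phi.
Variable alpha : cstar_action H A.

Lemma restrict_act1 a : alpha (phi 1%g) a = a.
Proof. by rewrite phi1 act1. Qed.

Lemma restrict_actM g h a :
  alpha (phi (g * h)%g) a = alpha (phi g) (alpha (phi h) a).
Proof. by rewrite phiM actM. Qed.

Lemma restrict_act_continuous a : continuous (fun g => alpha (phi g) a).
Proof.
move=> g; apply: (@continuous_comp _ _ _ phi (fun h => alpha h a)).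
  exact: phi_cont.
exact: act_continuous.
Qed.

Definition restrict_action : cstar_action G A :=
  CStarAction (fun g => act_hom alpha (phi g)) restrict_act1 restrict_actM
    restrict_act_continuous.
End RestrictAction.

Section WLT.
Variables (R : realType) (G : compactGroupType) (A : unitalCstarType R).
Variable alpha : cstar_action G A.

Definition invertible (a : A) := exists b, a ** b = sone /\ b ** a = sone.

Definition WLT_witness (m : nat)
    (rho : 'I_m.+1 -> C0 R (unitIoc R * G)%type -> A) :=
  [/\ forall i, star_hom (rho i),
      forall i g F, rho i (C0_rtrans g F) = alpha g (rho i F) &
      invertible (\sum_i rho i (C0_tensor (unitIoc_id R) (C0_one R G)))].

(* The least m with a witness rho_0, ..., rho_m; [None] stands for infinity. *)
Definition dim_WLT : option nat :=
  if pselect (exists m, `[< exists rho, @WLT_witness m rho >]) is left h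
  then Some (ex_minn h) else None.
End WLT.

Record digraph := Digraph {
  vertex : finType;
  edge : finType;
  src : edge -> vertex;
  rng : edge -> vertex
}.

Section GraphAlgebra.
Variables (R : realType) (E : digraph).

(* The order of a C*-algebra: b - a is positive. *)
Definition cstar_le (A : cstarType R) (a b : A) := exists c, b - a = star c ** c.

Definition is_projection (A : cstarType R) (p : A) := p ** p = p /\ star p = p.

Record CK_family (A : cstarType R) (P : vertex E -> A) (S : edge E -> A) : Prop :=
  CKFamily {
  CK_proj : forall v, is_projection (P v);
  CK_orth : forall v w, v != w -> P v ** P w = 0;
  CK_pisom : forall e, S e ** star (S e) ** S e = S e;
  CK_range_orth : forall e f, e != f ->
    (S e ** star (S e)) ** (S f ** star (S f)) = 0;
  CK_source : forall e, star (S e) ** S e = P (rng e);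
  CK_range_le : forall e, cstar_le (S e ** star (S e)) (P (src e));
  CK_sum : forall v, (exists e, src e = v) ->
    P v = \sum_(e | src e == v) S e ** star (S e)
}.

(* A is C*(E), with canonical generators P and S. Uniqueness of phi accounts for
   A being generated by P and S; B ranges over all C*-algebras, unital or not. *)
Definition is_graph_algebra (A : cstarType R) (P : vertex E -> A)
    (S : edge E -> A) :=
  CK_family P S /\
  forall (B : cstarType R) (Q : vertex E -> B) (U : edge E -> B),
    CK_family Q U ->
    exists! phi : A -> B, [/\ star_hom phi,
      forall v, phi (P v) = Q v & forall e, phi (S e) = U e].

Definition is_gauge_action (A : cstarType R) (P : vertex E -> A)
    (S : edge E -> A) (gamma : cstar_action (circle R) A) :=
  (forall z e, gamma z (S e) = (\val z : R[i]) *: S e) /\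
  (forall z v, gamma z (P v) = P v).
End GraphAlgebra.

Section Z2.
Variable R : realType.
Lemma circleN1_subproof : (-1 : R[i]^o) \in [set z : R[i]^o | `|z| = 1].
Proof. by apply/mem_set; rewrite /= normrN normr1. Qed.
Definition circleN1 : circle R := exist _ (-1) circleN1_subproof.

(* The inclusion of Z/2 = {1, -1} in the circle. *)
Definition Z2_circle (g : Z2) : circle R := (circleN1 ^+ (g : 'Z_2))%g.

Lemma Z2_circle1 : Z2_circle 1%g = 1%g.
Proof. by []. Qed.

Lemma Z2_circleM : {morph Z2_circle : g h / (g * h)%g}.
Proof.
have N1K : (circleN1 * circleN1 = 1)%g.
  by apply: val_inj; rewrite /= mulrNN mulr1.
move=> [[|[|//]] ?] [[|[|//]] ?]; rewrite /Z2_circle /= ?mulg1 ?mul1g //.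
Qed.

Lemma Z2_circle_continuous : continuous Z2_circle.
Proof.
move=> a U /nbhs_singleton Ua; apply: (@filterS _ (nbhs a) _ _ _ _ (discrete_set1 a)).
by move=> x ->.
Qed.

Definition Z2_restriction (A : cstarType R) (gamma : cstar_action (circle R) A) :
  cstar_action Z2 A :=
  restrict_action Z2_circle1 Z2_circleM Z2_circle_continuous gamma.
End Z2.

(* Vertices: v1 = false, v2 = true. Edges: false is the loop at v1, and true is
   the edge from v1 to v2. *)
Definition toeplitz_graph : digraph :=
  @Digraph bool bool (fun _ => false) id.

(* A is C*(V | V^* V = 1), universal among unital C*-algebras with an isometry.
   [toeplitz_graph_isometry] below shows that the graph algebra of
   [toeplitz_graph] is this algebra, V being the sum of the partial isometries S. *)
Definition is_universal_isometry (R : realType) (A : unitalCstarType R) (V : A) :=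
  star V ** V = sone /\
  forall (B : unitalCstarType R) (W : B), star W ** W = sone ->
    exists! phi : A -> B, [/\ star_hom phi, phi sone = sone & phi V = W].

Section StarTheory.
Variables (R : realType) (A : starAlgType R).
Implicit Types x y z : A.

Lemma smul0l x : 0 ** x = 0.
Proof. by apply: (addrI (0 ** x)); rewrite -smulDl !addr0. Qed.
Lemma smul0r x : x ** 0 = 0.
Proof. by apply: (addrI (x ** 0)); rewrite -smulDr !addr0. Qed.
Lemma smulNl x y : (- x) ** y = - (x ** y).
Proof. by apply: (addrI (x ** y)); rewrite -smulDl !subrr smul0l. Qed.
Lemma smulNr x y : x ** (- y) = - (x ** y).
Proof. by apply: (addrI (x ** y)); rewrite -smulDr !subrr smul0r. Qed.
Lemma star0 : star (0 : A) = 0.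
Proof. by apply: (addrI (star (0 : A))); rewrite -starD !addr0. Qed.
Lemma starN x : star (- x) = - star x.
Proof. by apply: (addrI (star x)); rewrite -starD !subrr star0. Qed.
End StarTheory.

Lemma star_hom0 (R : realType) (A B : starAlgType R) (f : A -> B) :
  star_hom f -> f 0 = 0.
Proof.
by move=> hf; apply: (addrI (f 0)); rewrite -(star_homD hf) !addr0.
Qed.

Lemma star1 (R : realType) (A : unitalCstarType R) : star (sone : A) = sone.
Proof. by rewrite -[LHS]smul1r -{2}[sone]starK -starM smul1r starK. Qed.

Section ToeplitzIdentification.
Variables (R : realType) (T : unitalCstarType R).
Variables (P : vertex toeplitz_graph -> T) (S : edge toeplitz_graph -> T).
Hypothesis PS : is_graph_algebra P S.
Let p : T := P false + P true.
Let V : T := S false + S true.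

Let PP v w : P v ** P w = if v == w then P v else 0.
Proof.
case: PS => CK _; case: eqP => [->|/eqP]; last exact: (CK_orth CK).
by have [] := CK_proj CK w.
Qed.

Let Pstar v : star (P v) = P v.
Proof. by case: PS => CK _; have [] := CK_proj CK v. Qed.

Let SP e v : S e ** P v = if e == v then S e else 0.
Proof.
case: PS => CK _.
have SPe : S e ** P e = S e by rewrite -(CK_source CK) smulA (CK_pisom CK).
by rewrite -SPe -smulA PP; case: eqP => // _; rewrite smul0r.
Qed.

Let PSs : P false = S false ** star (S false) + S true ** star (S true).
Proof.
case: PS => CK _; rewrite (CK_sum CK); last by exists false.
rewrite (eq_bigl xpredT) => [|e]; last by rewrite /= eqxx.
by rewrite big_bool addrC.
Qed.

Let PsS e v : P v ** star (S e) = if e == v then star (S e) else 0.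
Proof.
rewrite -[P v]Pstar -starM SP; case: eqP => // _; exact: star0.
Qed.

Let SsS e : star (S e) ** S e = P e.
Proof. by case: PS => CK _; rewrite (CK_source CK). Qed.

Let PSe e : P false ** S e = S e.
Proof.
case: PS => CK _.
have h f : f != e -> S f ** star (S f) ** S e = 0.
  by move=> fe; rewrite -[S e](CK_pisom CK) smulA (CK_range_orth CK fe) smul0l.
rewrite PSs smulDl.
case: e h => h; rewrite (CK_pisom CK).
  by rewrite (h false) // add0r.
by rewrite (h true) // addr0.
Qed.

Let pP v : p ** P v = P v.
Proof. by rewrite smulDl !PP; case: v; rewrite ?add0r ?addr0. Qed.

Let Pp v : P v ** p = P v.
Proof. by rewrite smulDr !PP; case: v; rewrite ?add0r ?addr0. Qed.

Let Sp e : S e ** p = S e.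
Proof. by rewrite smulDr !SP; case: e; rewrite ?add0r ?addr0. Qed.

Let pS e : p ** S e = S e.
Proof. by rewrite -[S e]PSe smulA pP. Qed.

Let pp : p ** p = p.
Proof. by rewrite {2}/p smulDr !pP. Qed.

Let pstar : star p = p.
Proof. by rewrite starD !Pstar. Qed.

Let fix_id (psi : T -> T) : star_hom psi -> (forall v, psi (P v) = P v) ->
  (forall e, psi (S e) = S e) -> psi = id.
Proof.
case: PS => CK /(_ _ _ _ CK) [phi [_ phiU]] h1 h2 h3.
by rewrite -(phiU psi) //; apply: phiU; split.
Qed.

Let local_unit_sone (q : T) : q ** q = q -> star q = q ->
  (forall v, q ** P v = P v) -> (forall v, P v ** q = P v) ->
  (forall e, q ** S e = S e) -> (forall e, S e ** q = S e) -> q = sone.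
Proof.
move=> qq qstar qP Pq qS Sq.
have [u uE] : exists u, u = q + q - sone by exists (q + q - sone).
have uu : u ** u = sone.
  rewrite uE !(smulDl, smulDr, smulNl, smulNr, smul1l, smul1r) !qq opprK.
  by rewrite !addrK -opprD addrA subrr add0r.
have us : star u = u by rewrite uE !starD starN star1 qstar.
have cu : (fun x => u ** x ** u) = id.
  apply: fix_id => [|v|e].
  - split=> [x y|c x|x y|x].
    + by rewrite /= smulDr smulDl.
    + by rewrite /= smulZr smulZl.
    + by rewrite /= !smulA -(smulA (u ** x) u u) uu smul1r.
    + by rewrite /= !starM us smulA.
  - by rewrite /= uE !(smulDl, smulDr, smulNl, smulNr, smul1l, smul1r) !qP !Pq !addrK.
  - by rewrite /= uE !(smulDl, smulDr, smulNl, smulNr, smul1l, smul1r) !qS !Sq !addrK.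
have pC x : q ** x = x ** q.
  have ux : u ** x = x ** u.
    by rewrite -[in RHS](congr1 (@^~ x) cu) /= -!smulA uu smul1r.
  move: ux; rewrite uE !(smulDl, smulDr, smulNl, smulNr, smul1l, smul1r).
  move/addIr => h; have two : (2%:R : R[i]) != 0 by rewrite pnatr_eq0.
  by apply: (scalerI two); rewrite !scaler_nat.
have pid : (fun x => q ** x) = id.
  apply: fix_id => // ; split=> [x y|c x|x y|x].
  - by rewrite /= smulDr.
  - by rewrite /= smulZr.
  - by rewrite /= -smulA (smulA x q y) -(pC x) !smulA qq.
  - by rewrite /= starM qstar pC.
by rewrite -[LHS]smul1r; exact: (congr1 (@^~ sone) pid).
Qed.

Let p_sone : p = sone.
Proof. exact: local_unit_sone. Qed.

Let SsSf e f : star (S e) ** S f = if e == f then P e else 0.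
Proof.
case: eqP => [->|/eqP ef]; first exact: SsS.
case: PS => CK _.
have -> : star (S e) = star (S e) ** (S e ** star (S e)).
  by rewrite -[in LHS](CK_pisom CK) !starM starK.
rewrite -[S f](CK_pisom CK) -!smulA (smulA (S f)) (smulA (S e)).
by rewrite (smulA (S e ** _)) (CK_range_orth CK ef) smul0l smul0r.
Qed.

Let VV : star V ** V = sone.
Proof.
by rewrite -p_sone /V starD smulDl !smulDr !SsSf /= addr0 add0r.
Qed.

Let VVs : V ** star V = P false.
Proof.
rewrite /V starD smulDl !smulDr PSs.
have h e f : e != f -> S e ** star (S f) = 0.
  move=> ef; have := SP e e; rewrite eqxx => <-.
  by rewrite -smulA PsS eq_sym (negbTE ef) smul0r.
by rewrite (h false true) // (h true false) // addr0 add0r.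
Qed.

Let VP e : V ** P e = S e.
Proof. by rewrite /V smulDl !SP; case: e; rewrite ?addr0 ?add0r. Qed.

Section Family.
Variables (B : unitalCstarType R) (W : B).
Hypothesis WW : star W ** W = sone.
Let r := W ** star W.
Let Q (v : vertex toeplitz_graph) : B := if v then sone - r else r.
Let U (e : edge toeplitz_graph) : B := W ** Q e.

Let rr : r ** r = r.
Proof. by rewrite /r -smulA (smulA (star W)) WW smul1l. Qed.
Let rs : star r = r.
Proof. by rewrite /r starM starK. Qed.
Let Qs v : star (Q v) = Q v.
Proof. by case: v; rewrite /Q ?starD ?starN ?star1 rs. Qed.
Let QQ v w : Q v ** Q w = if v == w then Q v else 0.
Proof.
rewrite /Q; case: v; case: w => /=;
  by rewrite ?(smulDl, smulDr, smulNl, smulNr, smul1l, smul1r) rr ?subrr ?subr0.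
Qed.
Let UsU e f : star (U e) ** U f = if e == f then Q e else 0.
Proof. by rewrite /U starM Qs -smulA (smulA (star W)) WW smul1l QQ. Qed.
Let sumU : U false ** star (U false) + U true ** star (U true) = r.
Proof.
have h e : U e ** star (U e) = W ** Q e ** star W.
  by rewrite /U starM Qs smulA -(smulA W) QQ eqxx.
by rewrite !h -smulDl -smulDr /Q addrC subrK smul1r.
Qed.

Lemma isometry_CK : CK_family Q U.
Proof.
have pis e : U e ** star (U e) ** U e = U e.
  by rewrite -smulA UsU eqxx /U -smulA QQ eqxx.
split=> [v|v w vw|//|e f ef|e|e|v [e <-]].
- by split; rewrite ?Qs // QQ eqxx.
- by rewrite QQ (negbTE vw).
- by rewrite smulA -(smulA (U e)) UsU (negbTE ef) smul0r smul0l.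
- by rewrite UsU eqxx.
- exists (star (U (~~ e))); rewrite starK -[Q _]sumU.
  by case: e; rewrite /= ?addrK // addrC addKr.
- rewrite (eq_bigl xpredT) => [|f]; last by rewrite /= eqxx.
  by rewrite -[LHS]sumU big_bool /= addrC.
Qed.

Lemma isometry_sumQ : Q false + Q true = sone.
Proof. by rewrite /Q addrC subrK. Qed.

Lemma isometry_sumU : U false + U true = W.
Proof. by rewrite /U -smulDr isometry_sumQ smul1r. Qed.

End Family.

Lemma toeplitz_graph_isometry : is_universal_isometry V.
Proof.
split=> [|B W WW]; first exact: VV.
have CKB := isometry_CK WW.
case: PS => CK /(_ _ _ _ CKB) [phi [[hphi phiP phiS] phiU]].
exists phi; split.
  split=> //; first by rewrite -p_sone (star_homD hphi) !phiP isometry_sumQ.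
  by rewrite (star_homD hphi) !phiS isometry_sumU.
move=> psi [hpsi psi1 psiV]; apply: phiU.
have psiP v : psi (P v) = if v then sone - W ** star W else W ** star W.
  have e0 : psi (P false) = W ** star W.
    by rewrite -VVs (star_homM hpsi) (star_hom_star hpsi) psiV.
  case: v => //; apply: (addrI (psi (P false))).
  by rewrite -(star_homD hpsi) -/p p_sone psi1 e0 addrC subrK.
by split=> // e; rewrite -VP (star_homM hpsi) psiV psiP.
Qed.
End ToeplitzIdentification.

(* Main.v *)
(* Upper bound. An odd self-adjoint contraction y defines an equivariant map of
   C_0((0,1]) (x) C(Z/2), the functions on [-1,1] vanishing at 0, by functional
   calculus, and t (x) 1 goes to |y|. Apply this to the real and imaginary parts
   y0, y1 of V. As |y| >= y^2, and y0^2 + y1^2 = (1 + V V^* ) / 2, the sum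
   |y0| + |y1| is at least 1/2, hence invertible. The functional calculus of x
   with 0 <= x <= 1 is the limit of the Bernstein polynomials of x: Bernstein's
   variance estimate holds in any C*-algebra and gives both the convergence and
   the multiplicativity.

   Lower bound. A single map rho would give an odd self-adjoint element
   x = rho (t (x) sign) with x^2 = rho (t (x) 1)^2 invertible. Let chi be the
   character V |-> 1. Then chi (gamma_z x) is a continuous real function of z on
   the circle, odd and without zeros, contradicting the intermediate value
   theorem. *)

From HB Require Import structures.
Require Import Defs.
From mathcomp Require Import all_boot all_order all_algebra.
From mathcomp Require Import complex.
From mathcomp Require Import all_classical all_reals all_analysis.
From mathcomp Require Import ring lra.

Set Implicit Arguments.
Unset Strict Implicit.
Unset Printing Implicit Defensive.

Import Order.TTheory GRing.Theory Num.Theory.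
Import numFieldNormedType.Exports.

Local Open Scope classical_set_scope.
Local Open Scope ring_scope.
Local Open Scope complex_scope.

(** * Real-valued norms and limits of sequences *)

(** Neither the spectrum nor the Gelfand transform is used. The analytic input is the C*-identity,
    completeness, and the inequality |a|^2 <= |a^2 + b^2| for commuting self-adjoint a and b.
    Together with square roots obtained from a contraction, it shows that commuting positive
    elements have a positive product and that -r <= E <= r implies |E| <= r. Bernstein's argument
    needs exactly this: positive weights, and a norm estimate from an order estimate. The square
    root of 1 - h is constructed for |h| < 1 only, hence the recurrent shift by a scalar e that
    finally tends to 0. Star homomorphisms are assumed neither unital nor continuous, so both
    properties are proved where they matter. The calculus lives on [0, 1], the home of Bernstein
    polynomials; through y = 2x - 1 the sign change of y becomes x |-> 1 - x. *)

Section RealNorm.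
Variables (R : realType) (V : normedModType R[i]).
Implicit Types (x y : V) (u v : nat -> V).

(** Norms of modules over [R[i]] are complex numbers. The real part loses nothing, by [nrmE], and
    lives in an ordered field where nonlinear arithmetic is available. *)
Definition nrm x : R := complex.Re `|x|.

Lemma nrmE x : `|x| = (nrm x)%:C.
Proof. by rewrite /nrm RRe_real// normr_real. Qed.

Lemma nrm_ge0 x : 0 <= nrm x.
Proof. by rewrite -ler0c -nrmE. Qed.

Lemma nrm_eq0 x : nrm x = 0 -> x = 0.
Proof. by move=> x0; apply/eqP; rewrite -normr_eq0 nrmE x0. Qed.

Lemma nrm0 : nrm (0 : V) = 0.
Proof. by rewrite /nrm normr0. Qed.

Lemma nrmD x y : nrm (x + y) <= nrm x + nrm y.
Proof. by rewrite -lecR rmorphD/= -!nrmE ler_normD. Qed.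

Lemma nrmN x : nrm (- x) = nrm x.
Proof. by rewrite /nrm normrN. Qed.

Lemma nrmB x y : nrm (x - y) <= nrm x + nrm y.
Proof. by rewrite -(nrmN y); exact: nrmD. Qed.

Lemma nrm_dist x y : nrm (x - y) = nrm (y - x).
Proof. by rewrite -nrmN opprB. Qed.

Lemma nrm_tri z x y : nrm (x - y) <= nrm (x - z) + nrm (z - y).
Proof. by apply: le_trans (nrmD _ _); rewrite addrA subrK. Qed.

Lemma nrmZ (c : R[i]) x : nrm (c *: x) = complex.Re `|c| * nrm x.
Proof.
apply: complexI; rewrite rmorphM/= -!nrmE normrZ// ?normr_real//.
Qed.

Lemma nrmZr (r : R) x : nrm (r%:C *: x) = `|r| * nrm x.
Proof. by rewrite nrmZ normc_def/= expr0n addr0 sqrtr_sqr. Qed.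

Lemma nrm_le0 x : nrm x <= 0 -> x = 0.
Proof. by move=> x0; apply: nrm_eq0; apply/le_anti; rewrite x0 nrm_ge0. Qed.

Definition tends u x :=
  forall e : R, 0 < e -> exists N, forall n, (N <= n)%N -> nrm (u n - x) <= e.

Lemma tends_cst x : tends (fun=> x) x.
Proof. by move=> e e0; exists 0%N => n _; rewrite subrr nrm0 ltW. Qed.

Lemma tends_bound u x (M : R) : 0 <= M ->
  (forall e : R, 0 < e -> exists N, forall n, (N <= n)%N -> nrm (u n - x) <= M * e) ->
  tends u x.
Proof.
move=> M0 h e e0; have M1 : 0 < M + 1 by lra.
have [N hN] := h _ (divr_gt0 e0 M1).
exists N => n /hN /le_trans; apply; rewrite mulrA ler_pdivrMr//; nra.
Qed.

Lemma tendsD u v x y : tends u x -> tends v y -> tends (fun n => u n + v n) (x + y).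
Proof.
move=> ux vy; apply: (@tends_bound _ _ 2) => // e e0.
have [N hN] := ux _ e0; have [N' hN'] := vy _ e0.
exists (maxn N N') => n; rewrite geq_max => /andP[/hN ? /hN' ?].
by rewrite opprD addrACA (le_trans (nrmD _ _))//; lra.
Qed.

Lemma tendsZ (c : R[i]) u x : tends u x -> tends (fun n => c *: u n) (c *: x).
Proof.
move=> ux; apply: (@tends_bound _ _ (complex.Re `|c|)).
  by rewrite -ler0c RRe_real ?normr_real.
move=> e /ux[N hN]; exists N => n /hN h; rewrite -scalerBr nrmZ ler_wpM2l//.
by rewrite -ler0c RRe_real ?normr_real.
Qed.

Lemma tendsB u v x y : tends u x -> tends v y -> tends (fun n => u n - v n) (x - y).
Proof.
move=> ux /(tendsZ (-1)); rewrite scaleN1r => vy.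
by have := tendsD ux vy; under [X in tends X]eq_fun do rewrite scaleN1r.
Qed.

Lemma tends_nrm_le u x (M : R) : tends u x -> (forall n, nrm (u n) <= M) -> nrm x <= M.
Proof.
move=> ux uM; apply/ler_addgt0Pl => e /ux[N /(_ _ (leqnn N))].
have := nrm_tri (u N) x 0; rewrite !subr0 nrm_dist; have := uM N; lra.
Qed.

Lemma tends_uniq u x y : tends u x -> tends u y -> x = y.
Proof.
move=> ux uy; apply/eqP; rewrite -subr_eq0; apply/eqP/nrm_le0.
apply: (tends_nrm_le (tendsB ux uy)) => n; by rewrite subrr nrm0.
Qed.

Lemma tends_dist0 u v x : tends u x -> tends (fun n => v n - u n) 0 -> tends v x.
Proof.
move=> ux vu; have := tendsD ux vu; rewrite addr0.
by under [X in tends X]eq_fun do rewrite addrC subrK.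
Qed.

End RealNorm.

Section Complete.
Variables (R : realType) (V : completeNormedModType R[i]).

Lemma cauchy_tends (u : nat -> V) :
  (forall e : R, 0 < e -> exists N, forall n m, (N <= n)%N -> (N <= m)%N ->
     nrm (u n - u m) <= e) ->
  exists x, tends u x.
Proof.
move=> uC; have : cvg (u @ \oo).
  apply: cauchy_cvg; apply: cauchy_exP => e e0.
  have eE : e = (complex.Re e)%:C by rewrite RRe_real// gtr0_real.
  have e20 : 0 < complex.Re e / 2 by rewrite divr_gt0// -(ltcR 0) -eE.
  have [N hN] := uC _ e20; exists (u N); exists N => // n Nn /=.
  rewrite -ball_normE /= nrmE eE ltcR (le_lt_trans (hN _ _ _ Nn))//; lra.
move=> /cvg_ex[x ux]; exists x => e e0.
have eC : 0 < e%:C by rewrite (ltcR 0).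
have [N _ hN] := (proj1 (cvgrPdist_le _ _) ux) _ eC; exists N => n /hN /=.
by rewrite nrmE lecR nrm_dist.
Qed.

Lemma expr_small (q M e : R) : 0 <= q < 1 -> 0 <= M -> 0 < e ->
  exists N, forall n, (N <= n)%N -> q ^+ n * M <= e.
Proof.
move=> /andP[q0 q1] M0 e0; have M1 : 0 < M + 1 by lra.
have qc : `|q| < 1 by rewrite ger0_norm.
have [N _ hN] := (proj1 (cvgrPdist_le _ _) (cvg_expr qc)) _ (divr_gt0 e0 M1).
exists N => n /hN; rewrite /= sub0r normrN ger0_norm ?exprn_ge0// => h.
apply: (@le_trans _ _ (q ^+ n * (M + 1))); first by rewrite ler_wpM2l ?exprn_ge0//; lra.
by rewrite -ler_pdivlMr.
Qed.

(** Banach's theorem on a sequentially closed set. Extra properties of the fixed point, such as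
    self-adjointness or commutation, are obtained by putting them into [S]. *)
Lemma contraction_fix (S : V -> Prop) (f : V -> V) (q : R) (s : V) : 0 <= q < 1 ->
  (forall u x, (forall n, S (u n)) -> tends u x -> S x) ->
  (forall x, S x -> S (f x)) ->
  (forall x y, S x -> S y -> nrm (f x - f y) <= q * nrm (x - y)) ->
  S s -> exists2 x, S x & f x = x.
Proof.
move=> q01 Scl fS fq Ss; have [/andP[q0 q1]] := (q01, q01).
pose u n := iter n f s; have uS n : S (u n) by elim: n => //= n; exact: fS.
(* The sum of the geometric series of step lengths. The equation [KE] makes the ball of radius [K]
   around [s] stable along the orbit. *)
pose K := nrm (f s - s) / (1 - q).
have q10 : 0 < 1 - q by lra.
have K0 : 0 <= K by rewrite divr_ge0 ?nrm_ge0// ltW.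
have KE : K = q * K + nrm (f s - s).
  have h : K * (1 - q) = nrm (f s - s) by rewrite /K divfK ?gt_eqF.
  by lra.
have u0K m : nrm (u m - s) <= K.
  elim: m => [|m ih]; first by rewrite subrr nrm0.
  apply: (le_trans (nrm_tri (f s) _ _)); rewrite [leRHS]KE lerD2r.
  by apply: (le_trans (fq _ _ (uS m) Ss)); rewrite ler_wpM2l.
have uK n m : nrm (u (n + m)%N - u n) <= q ^+ n * K.
  elim: n => [|n ih]; first by rewrite expr0 mul1r u0K.
  rewrite addSn /=; apply: (le_trans (fq _ _ (uS _) (uS _))).
  by rewrite exprS -mulrA ler_wpM2l.
have [|x ux] := @cauchy_tends u.
  move=> e e0; have [N hN] := expr_small q01 K0 e0; exists N => n m Nn Nm.
  wlog nm : n m Nn Nm / (n <= m)%N => [H|].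
    by case/orP: (leq_total n m) => nm; [|rewrite nrm_dist]; exact: H.
  rewrite nrm_dist -(subnKC nm); apply: (le_trans (uK _ _)); exact: hN.
have Sx : S x by exact: (Scl u).
exists x => //; apply: (@tends_uniq _ _ (fun n => u n.+1)).
  apply: (@tends_bound _ _ _ _ q) => // e /ux[N hN].
  exists N => n /hN h; apply: (le_trans (fq _ _ (uS n) Sx)).
  by rewrite ler_wpM2l.
move=> e /ux[N hN]; exists N => n Nn; apply: hN; exact: leqW.
Qed.

End Complete.

(** * Positive elements and contractivity *)

(* The module structure carried by [starAlgType] does not unify with the lemmas
   on scaling, and its product is not a ring product. So a nonzero unital
   C*-algebra is copied to a type that is canonically an algebra. *)
Definition calg (R : realType) (A : unitalCstarType R) (_ : sone != 0 :> A) : Type := A.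

Section CalgInstances.
Variables (R : realType) (A : unitalCstarType R) (A1 : sone != 0 :> A).
HB.instance Definition _ := CompleteNormedModule.copy (calg A1) A.
HB.instance Definition _ := GRing.Zmodule_isNzRing.Build (calg A1)
  (@smulA R A) (@smul1l R A) (@smul1r R A) (@smulDl R A) (@smulDr R A) A1.

Lemma calg_scalerAl (c : R[i]) (x y : calg A1) : c *: (x * y) = (c *: x) * y.
Proof. by symmetry; exact: (@smulZl R A). Qed.
HB.instance Definition _ := GRing.Lmodule_isLalgebra.Build R[i] (calg A1) calg_scalerAl.

Lemma calg_scalerAr (c : R[i]) (x y : calg A1) : c *: (x * y) = x * (c *: y).
Proof. by symmetry; exact: (@smulZr R A). Qed.
HB.instance Definition _ := GRing.Lalgebra_isAlgebra.Build R[i] (calg A1) calg_scalerAr.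
End CalgInstances.

Section CStar.
Variables (R : realType) (A : unitalCstarType R) (A1 : sone != 0 :> A).
Local Notation T := (calg A1).
Implicit Types (x y z a b c h k : T) (r s t e : R).

Definition adj (x : T) : T := star (x : A).
Local Notation "x ^†" := (adj x) (at level 2, format "x ^†").

Lemma adjK x : (x^†)^† = x. Proof. exact: starK. Qed.
Lemma adjD x y : (x + y)^† = x^† + y^†. Proof. exact: starD. Qed.
Lemma adjM x y : (x * y)^† = y^† * x^†. Proof. exact: starM. Qed.
Lemma adjZ (c : R[i]) x : (c *: x)^† = conjc c *: x^†. Proof. exact: starZ. Qed.
Lemma adj1 : 1^† = 1. Proof. exact: star1. Qed.
Lemma adj0 : 0^† = 0. Proof. exact: star0. Qed.
Lemma adjN x : (- x)^† = - x^†. Proof. exact: starN. Qed.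
Lemma adjB x y : (x - y)^† = x^† - y^†. Proof. by rewrite adjD adjN. Qed.
Lemma adjZr r x : (r%:C *: x)^† = r%:C *: x^†.
Proof. by rewrite adjZ conjc_real. Qed.
Lemma adjA r : (r%:C%:A)^† = r%:C%:A. Proof. by rewrite adjZr adj1. Qed.

Lemma nrmM x y : nrm (x * y) <= nrm x * nrm y.
Proof. by rewrite -lecR rmorphM/= -!nrmE; exact: (@norm_smul R A). Qed.

Lemma nrm_adj_mul x : nrm (x^† * x) = nrm x ^+ 2.
Proof. by apply: complexI; rewrite rmorphXn/= -!nrmE; exact: (@norm_star_smul R A). Qed.

Lemma nrm_adj x : nrm x^† = nrm x.
Proof.
suff H y : nrm y <= nrm y^† by apply/le_anti; rewrite H -{2}[x]adjK H.
have := nrm_adj_mul y; have := nrmM y^† y.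
by have := nrm_ge0 y; have := nrm_ge0 y^†; nra.
Qed.

Lemma nrm1_le1 : nrm (1 : T) <= 1.
Proof.
have := nrm_adj_mul 1; rewrite mulr1 adj1; have := nrm_ge0 (1 : T); nra.
Qed.

Lemma nrm_sqr a : a^† = a -> nrm (a * a) = nrm a ^+ 2.
Proof. by move=> sa; rewrite -nrm_adj_mul sa. Qed.

Lemma nrm_scalar_le r : 0 <= r -> nrm (r%:C%:A : T) <= r.
Proof. by move=> r0; rewrite nrmZr ger0_norm//; have := nrm1_le1; nra. Qed.

Lemma tends_adj (u : nat -> T) x : tends u x -> tends (fun n => (u n)^†) x^†.
Proof. by move=> ux e /ux[N hN]; exists N => n /hN; rewrite -adjB nrm_adj. Qed.

Lemma tendsM (u v : nat -> T) x y :
  tends u x -> tends v y -> tends (fun n => u n * v n) (x * y).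
Proof.
move=> ux vy; have nx := nrm_ge0 x; have ny := nrm_ge0 y.
apply: (@tends_bound _ _ _ _ (nrm x + 1 + nrm y)); first by lra.
move=> e e0; have [N1 h1] := ux _ e0; have [N2 h2] := ux _ ltr01.
have [N3 h3] := vy _ e0; exists (maxn N1 (maxn N2 N3)) => n.
rewrite !geq_max => /and3P[/h1 ue /h2 ule /h3 ve].
have -> : u n * v n - x * y = u n * (v n - y) + (u n - x) * y.
  by rewrite mulrBl mulrBr addrA subrK.
apply: (le_trans (nrmD _ _)).
have un : nrm (u n) <= nrm x + 1.
  by have := nrm_tri x (u n) 0; rewrite !subr0; lra.
have := nrmM (u n) (v n - y); have := nrmM (u n - x) y.
have := nrm_ge0 (v n - y); have := nrm_ge0 (u n - x); have := nrm_ge0 (u n).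
nra.
Qed.

Lemma scale_half_add x : (2^-1 : R)%:C *: (x + x) = x.
Proof.
rewrite scalerDr -scalerDl -rmorphD/= (_ : 2^-1 + 2^-1 = 1 :> R) ?scale1r//.
by field.
Qed.

(* For commuting self-adjoint a and b, the element u = a + ib satisfies
   u^* u = a^2 + b^2 and a = (u + u^* ) / 2. *)
Lemma nrm_sqr_le_addsqr a b : a^† = a -> b^† = b -> a * b = b * a ->
  nrm a ^+ 2 <= nrm (a * a + b * b).
Proof.
move=> sa sb ab; pose u := a + 'i%C *: b.
have su : u^† = a - 'i%C *: b.
  rewrite adjD adjZ sa sb; congr (_ + _).
  by rewrite -scaleNr; congr (_ *: _); apply/eqP; rewrite eq_complex /= oppr0 !eqxx.
have uu : u^† * u = a * a + b * b.
  have i2 : ('i%C : R[i]) * 'i%C = -1 by rewrite -expr2 sqr_i.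
  rewrite su /u mulrDr !mulrBl -scalerAl -!scalerAr -scalerAl ab scalerA i2.
  by rewrite scaleN1r opprK addrA subrK.
have ua : (2^-1 : R)%:C *: (u + u^†) = a.
  by rewrite su /u addrACA subrr addr0 scale_half_add.
have : nrm (u + u^†) <= 2 * nrm u.
  by apply: (le_trans (nrmD _ _)); rewrite nrm_adj; lra.
rewrite -uu nrm_adj_mul -ua nrmZr ger0_norm ?invr_ge0//.
have := nrm_ge0 u; have := nrm_ge0 (u + u^†); nra.
Qed.

(** With c = 1 - y, the equation c^2 = 1 - h reads y = (h + y^2) / 2, and the right-hand side is a
    q-contraction of the ball of radius q. Commutation with all that commutes with h is a closed
    condition; it later makes the square roots of commuting elements commute. *)
Lemma sqrt_one_sub h q : h^† = h -> nrm h <= q -> q < 1 ->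
  exists c, [/\ c^† = c, c * c = 1 - h & forall z, z * h = h * z -> z * c = c * z].
Proof.
move=> sh hq q1; have q0 : 0 <= q := le_trans (nrm_ge0 h) hq.
pose S y := [/\ nrm y <= q, y^† = y & forall z, z * h = h * z -> z * y = y * z].
pose f y : T := (2^-1 : R)%:C *: (h + y * y).
have [|||||y [ny sy cy] yE] := @contraction_fix R T S f q 0; first by rewrite q0.
- move=> u x Su ux; split.
  + by apply: (tends_nrm_le ux) => n; have [] := Su n.
  + apply: (tends_uniq (tends_adj ux)).
    rewrite (_ : (fun n => _) = u)//.
    by apply/funext => n; have [_ ->] := Su n.
  + move=> z zh; apply: (tends_uniq (tendsM (tends_cst z) ux)).
    rewrite (_ : (fun n => _) = (fun n => u n * z)); first exact: tendsM ux (tends_cst z).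
    by apply/funext => n; have [_ _ ->] := Su n.
- move=> y [ny sy cy]; split.
  + rewrite nrmZr ger0_norm ?invr_ge0//; have := nrmD h (y * y).
    by rewrite nrm_sqr//; have := nrm_ge0 y; nra.
  + by rewrite adjZr adjD sh adjM sy.
  + move=> z zh; have zy := cy z zh.
    by rewrite /f -scalerAr -scalerAl mulrDr mulrDl zh mulrA zy -mulrA zy mulrA.
- move=> y z [ny _ _] [nz _ _].
  rewrite -scalerBr opprD addrACA subrr add0r nrmZr ger0_norm ?invr_ge0//.
  have -> : y * y - z * z = y * (y - z) + (y - z) * z.
    by rewrite mulrBl mulrBr addrA subrK.
  have := nrmD (y * (y - z)) ((y - z) * z).
  have := nrmM y (y - z); have := nrmM (y - z) z; have := nrm_ge0 (y - z); nra.
- by split; rewrite ?nrm0 ?adj0// => z _; rewrite mul0r mulr0.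
exists (1 - y); split.
- by rewrite adjB adj1 sy.
- have h2 : y + y = h + y * y.
    by rewrite -{1 2}yE -scalerDr scale_half_add.
  rewrite mulrBl !mulrBr !mul1r !mulr1 opprB addrCA -addrA -opprD h2.
  by rewrite opprD addrC addrA subrK.
- by move=> z zh; rewrite mulrBl mulrBr mul1r mulr1 cy.
Qed.

Lemma one_sub_invertible w q : w^† = w -> nrm w <= q -> q < 1 ->
  exists y : T, (1 - w) * y = 1 /\ y * (1 - w) = 1.
Proof.
move=> sw wq q1; have q0 : 0 <= q := le_trans (nrm_ge0 w) wq.
have [|//|//||//|y _ yE] := @contraction_fix R T (fun=> True) (fun y => 1 + w * y) q 0.
- by rewrite q0.
- move=> x y _ _; rewrite opprD addrACA subrr add0r -mulrBr.
  by apply: (le_trans (nrmM _ _)); rewrite ler_wpM2r ?nrm_ge0.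
have yE1 : (1 - w) * y = 1 by rewrite mulrBl mul1r -{1}yE addrK.
(* The fixed point is only a right inverse. As [w] is self-adjoint, its adjoint is a left inverse,
   and the two coincide. *)
have yE2 : y^† * (1 - w) = 1.
  by rewrite -[LHS]adjK adjM adjK adjB adj1 sw yE1 adj1.
have yy : y^† = y by rewrite -[LHS]mulr1 -yE1 mulrA yE2 mul1r.
by exists y; split => //; rewrite -{1}yy.
Qed.

(* This is positivity in the C*-order, in a form which makes sums of positive
   elements visibly positive: h is self-adjoint with spectrum in [0, 2t]. *)
Definition pos h := h^† = h /\ exists2 t, 0 <= t & nrm (t%:C%:A - h) <= t.

Lemma pos_sa h : pos h -> h^† = h.
Proof. by case. Qed.

Lemma posD h k : pos h -> pos k -> pos (h + k).
Proof.
move=> [sh [s s0 hs]] [sk [t t0 kt]]; split; first by rewrite adjD sh sk.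
exists (s + t); first exact: addr_ge0.
rewrite rmorphD scalerDl opprD addrACA; apply: (le_trans (nrmD _ _)); exact: lerD.
Qed.

Lemma posZ r h : 0 <= r -> pos h -> pos (r%:C *: h).
Proof.
move=> r0 [sh [t t0 ht]]; split; first by rewrite adjZr sh.
exists (r * t); first exact: mulr_ge0.
by rewrite rmorphM -scalerA -scalerBr nrmZr ger0_norm// ler_wpM2l.
Qed.

Lemma pos_scalar r : 0 <= r -> pos (r%:C%:A).
Proof.
by move=> r0; split; [rewrite adjA|exists r => //; rewrite subrr nrm0].
Qed.

Lemma pos1 : pos 1.
Proof. by rewrite -(scale1r 1) -(rmorph1 (real_complex R)); exact: pos_scalar. Qed.

Lemma pos0 : pos 0.
Proof. by rewrite -(scale0r 1) -(rmorph0 (real_complex R)); exact: pos_scalar. Qed.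

Lemma pos_sum (I : finType) (F : I -> T) : (forall i, pos (F i)) -> pos (\sum_i F i).
Proof. by move=> h; elim/big_ind: _ => //; [exact: pos0|exact: posD]. Qed.

Lemma pos_sub r h : h^† = h -> nrm h <= r -> pos (r%:C%:A - h).
Proof.
move=> sh hr; split; first by rewrite adjB adjA sh.
exists r; first by apply: le_trans hr; exact: nrm_ge0.
by rewrite opprB addrC subrK.
Qed.

(** Here h + e = (t + e)(1 - w) with |w| <= t / (t + e), and the shift by e makes this bound
    strictly less than 1. *)
Lemma pos_sqrt h e : pos h -> 0 < e -> exists c,
  [/\ c^† = c, c * c = h + e%:C%:A & forall z, z * h = h * z -> z * c = c * z].
Proof.
move=> [sh [t t0 ht]] e0; have te : 0 < t + e by lra.
pose w : T := (t + e)^-1%:C *: (t%:C%:A - h).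
have sw : w^† = w by rewrite adjZr adjB adjA sh.
have nw : nrm w <= t / (t + e).
  have ti : 0 <= (t + e)^-1 by rewrite invr_ge0 ltW.
  by rewrite nrmZr ger0_norm// mulrC ler_wpM2r.
have [|c [sc cc ch]] := sqrt_one_sub sw nw; first by rewrite ltr_pdivrMr//; lra.
exists ((Num.sqrt (t + e))%:C *: c); split.
- by rewrite adjZr sc.
- rewrite -scalerAl -scalerAr scalerA -rmorphM/= -expr2 sqr_sqrtr ?ltW// cc scalerBr.
  rewrite /w scalerA -rmorphM/= divff ?gt_eqF// scale1r opprB rmorphD scalerDl.
  by rewrite addrC addrA subrK.
- move=> z zh; rewrite -scalerAl -scalerAr ch// /w -scalerAl -scalerAr mulrBl mulrBr zh.
  by rewrite -scalerAl -scalerAr mul1r mulr1.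
Qed.

(** After scaling to t = 1, write 1 - b^2 = c^2 with c commuting with b. Then c^2 + b^2 = 1, so
    |c|^2 <= 1. *)
Lemma nrm_sub_sqr b t : b^† = b -> nrm b ^+ 2 < t -> nrm (t%:C%:A - b * b) <= t.
Proof.
move=> sb bt; have t0 : 0 < t by apply: le_lt_trans bt; exact: sqr_ge0.
have ti0 : 0 <= t^-1 by rewrite invr_ge0 ltW.
pose b' : T := (Num.sqrt t^-1)%:C *: b.
have bb : b' * b' = t^-1%:C *: (b * b).
  by rewrite -scalerAl -scalerAr scalerA -rmorphM/= -expr2 sqr_sqrtr.
have sb' : b'^† = b' by rewrite adjZr sb.
have [|||c [sc cc ch]] := @sqrt_one_sub (b' * b') (t^-1 * nrm b ^+ 2).
- by rewrite adjM sb'.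
- by rewrite bb nrmZr ger0_norm// nrm_sqr.
- by rewrite mulrC ltr_pdivrMr// mul1r.
have := nrm_sqr_le_addsqr sc sb' (esym (ch b' (mulrA _ _ _))).
rewrite cc subrK => /le_trans /(_ nrm1_le1); rewrite -nrm_sqr// cc => h.
have -> : t%:C%:A - b * b = t%:C *: (1 - b' * b').
  by rewrite scalerBr bb scalerA -rmorphM/= divff ?gt_eqF// scale1r.
by rewrite nrmZr ger0_norm ?(ltW t0)//; have := nrm_ge0 (1 - b' * b'); nra.
Qed.

Lemma pos_sqr b : b^† = b -> pos (b * b).
Proof.
move=> sb; split; first by rewrite adjM sb.
have b0 := sqr_ge0 (nrm b).
exists (nrm b ^+ 2 + 1); first by lra.
by apply: nrm_sub_sqr => //; lra.
Qed.

(** If p^2 = h + e and q^2 = k + e, then p and q commute and (h + e)(k + e) is the square of the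
    self-adjoint pq. Squares satisfy the norm condition of [pos], which survives the limit e ->
    0. *)
Lemma posM h k : pos h -> pos k -> h * k = k * h -> pos (h * k).
Proof.
move=> ph pk hk; have [sh sk] := (pos_sa ph, pos_sa pk).
split; first by rewrite adjM sh sk.
have h0 := nrm_ge0 h; have k0 := nrm_ge0 k.
(* Chosen before [e]: it exceeds the norm of (h + e)(k + e) for every e <= 1. *)
pose t := (nrm h + 1) * (nrm k + 1) + 1; have t0 : 0 <= t by rewrite /t; nra.
exists t => //; apply/ler_addgt0Pl => d d0.
(* For e <= 1 the products (h + e)(k + e) and hk differ by at most e K in norm. *)
pose K := nrm h + nrm k + 1; have K0 : 0 < K by rewrite /K; lra.
pose e := Num.min 1 (d / K).
have e0 : 0 < e by rewrite lt_min ltr01 divr_gt0.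
have e1 : e <= 1 by rewrite ge_min lexx.
have eK : e * K <= d by rewrite -ler_pdivlMr// ge_min lexx orbT.
have [p [sp pp ch]] := pos_sqrt ph e0; have [q [sq qq ck]] := pos_sqrt pk e0.
have pq : p * q = q * p by apply: ck; rewrite ch.
pose E : T := e%:C%:A.
have eu : nrm E <= e by apply: nrm_scalar_le; exact: ltW.
have pqpq : (p * q) * (p * q) = (h + E) * (k + E).
  by rewrite -pp -qq -!mulrA (mulrA q) -pq -!mulrA.
have spq : (p * q)^† = p * q by rewrite adjM sp sq pq.
have nb : nrm (p * q) ^+ 2 < t.
  rewrite -nrm_sqr// pqpq; apply: (le_lt_trans (nrmM _ _)).
  have := nrmD h E; have := nrmD k E.
  have := nrm_ge0 (h + E); have := nrm_ge0 (k + E).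
  rewrite /t; nra.
have := nrm_sub_sqr spq nb; rewrite pqpq => H.
have -> : t%:C%:A - h * k = (t%:C%:A - (h + E) * (k + E)) + ((h + E) * (k + E) - h * k).
  by rewrite addrA subrK.
have -> : (h + E) * (k + E) - h * k = (h + E) * E + E * k.
  by rewrite mulrDr [(h + E) * k]mulrDl addrC -addrA addKr addrC.
have := nrmD (t%:C%:A - (h + E) * (k + E)) ((h + E) * E + E * k).
have := nrmD ((h + E) * E) (E * k); have := nrmM (h + E) E; have := nrmM E k.
have := nrmD h E; have := nrm_ge0 E; have := nrm_ge0 (h + E).
rewrite /K in eK; nra.
Qed.

(** With p^2 = r - E + e and q^2 = r + E + e, the commuting elements E and pq satisfy E^2 + (pq)^2 =
    (r + e)^2. *)
Lemma nrm_le_of_pos E r : E^† = E -> 0 <= r -> pos (r%:C%:A - E) -> pos (r%:C%:A + E) ->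
  nrm E <= r.
Proof.
move=> sE r0 pm pp; apply/ler_addgt0Pl => e e0.
have [p [sp p2 cp]] := pos_sqrt pm e0; have [q [sq q2 cq]] := pos_sqrt pp e0.
have Ep : E * p = p * E.
  by apply: cp; rewrite mulrBl mulrBr -scalerAl -scalerAr mul1r mulr1.
have Eq : E * q = q * E.
  by apply: cq; rewrite mulrDl mulrDr -scalerAl -scalerAr mul1r mulr1.
have pq : p * q = q * p.
  by apply: cq; rewrite mulrDl mulrDr -scalerAl -scalerAr mul1r mulr1 Ep.
have spq : (p * q)^† = p * q by rewrite adjM sp sq pq.
have E2 : E * E + (p * q) * (p * q) = (e + r)%:C%:A * (e + r)%:C%:A.
  have -> : p * q * (p * q) = (p * p) * (q * q) by rewrite -!mulrA (mulrA q) -pq -!mulrA.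
  pose S : T := (e + r)%:C%:A.
  have SE : S * E = E * S by rewrite -scalerAl -scalerAr mul1r mulr1.
  rewrite p2 q2 -/S addrAC -scalerDl -rmorphD/= (addrC r) -/S.
  rewrite [r%:C%:A + E + _]addrAC -scalerDl -rmorphD/= (addrC r) -/S.
  by rewrite mulrBl !mulrDr SE addrC opprD addrA addrK subrK.
have := nrm_sqr_le_addsqr sE spq; rewrite mulrA Ep -mulrA Eq mulrA => /(_ erefl).
rewrite E2 nrm_sqr ?adjA// => h.
have := @nrm_scalar_le (e + r); have := nrm_ge0 E; have := nrm_ge0 ((e + r)%:C%:A : T).
move=> + + /(_ (ltW _)); nra.
Qed.

End CStar.

Section Contractive.
Variables (R : realType) (A B : unitalCstarType R).
Variables (A1 : sone != 0 :> A) (B1 : sone != 0 :> B).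

(** If y is self-adjoint with |y| < 1 and c^2 = 1 - y^2, then f(y)^2 + f(c)^2 = 1, so |f(y)| <= 1.
    Scaling settles self-adjoint elements, and the C*-identity the others. *)
Lemma star_hom_contractive (f : calg A1 -> calg B1) :
  star_hom (f : A -> B) -> f 1 = 1 -> forall x, nrm (f x) <= nrm x.
Proof.
move=> hf f1.
have fD x y : f (x + y) = f x + f y := star_homD hf x y.
have fM x y : f (x * y) = f x * f y := star_homM hf x y.
have fZ (c : R[i]) x : f (c *: x) = c *: f x by exact: star_homZ hf c x.
have fs x : f (adj x) = adj (f x) := star_hom_star hf x.
have sa x : adj x = x -> nrm (f x) <= nrm x.
  move=> sx; apply/ler_addgt0Pl => e e0.
  have x0 := nrm_ge0 x; have t0 : 0 < e + nrm x by lra.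
  have ti : 0 <= (e + nrm x)^-1 by rewrite invr_ge0 ltW.
  pose y : calg A1 := (e + nrm x)^-1%:C *: x.
  have sy : adj y = y by rewrite adjZr sx.
  have ny : nrm y < 1.
    by rewrite nrmZr ger0_norm// mulrC ltr_pdivrMr//; lra.
  have y0 := nrm_ge0 y.
  have [|||c [sc cc ch]] := @sqrt_one_sub _ _ _ (y * y) (nrm y ^+ 2).
  - by rewrite adjM sy.
  - by rewrite nrm_sqr.
  - by nra.
  have yc : y * c = c * y by apply: ch; rewrite mulrA.
  have := @nrm_sqr_le_addsqr _ _ B1 (f y) (f c).
  rewrite -!fs sy sc -!fM yc -fD cc addrC subrK f1.
  move=> /(_ erefl erefl erefl) /le_trans /(_ (nrm1_le1 _)) fy.
  have fy1 : nrm (f y) <= 1 by have := nrm_ge0 (f y); nra.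
  have xE : (e + nrm x)%:C *: y = x.
    by rewrite scalerA -rmorphM/= divff ?gt_eqF// scale1r.
  by rewrite -{1}xE fZ nrmZr ger0_norm ?(ltW t0)//; nra.
move=> x; have := sa (adj x * x); rewrite adjM adjK => /(_ erefl).
rewrite fM fs !nrm_adj_mul; have := nrm_ge0 x; have := nrm_ge0 (f x); nra.
Qed.

End Contractive.

(** * Bernstein polynomials *)

Section Bernstein.
Variables (R : realType) (A : unitalCstarType R) (A1 : sone != 0 :> A).
Local Notation T := (calg A1).
Implicit Types (x y z : T) (r s t e : R) (f g : R -> R[i]).

Lemma scale_natE n x : (n%:R : R)%:C *: x = x *+ n.
Proof. by rewrite rmorph_nat scaler_nat. Qed.

Lemma pos_exp x n : pos x -> pos (x ^+ n).
Proof.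
move=> px; elim: n => [|n ih]; first exact: pos1.
by rewrite exprS; apply: posM => //; rewrite -exprSr exprS.
Qed.

Definition bern x n k : T :=
  ('C(n, k)%:R : R)%:C *: ((1 - x) ^+ (n - k) * x ^+ k).

Lemma comm_onem x : GRing.comm (1 - x) x.
Proof. by rewrite /GRing.comm mulrBl mulrBr mul1r mulr1. Qed.

Lemma bern_comm x n k m l : bern x n k * bern x m l = bern x m l * bern x n k.
Proof.
have c1 i j : GRing.comm ((1 - x) ^+ i) (x ^+ j) by apply/commrX/commr_sym/commrX/commr_sym/comm_onem.
have c2 i j i' j' : GRing.comm ((1 - x) ^+ i * x ^+ j) ((1 - x) ^+ i' * x ^+ j').
  apply: commrM; apply: commr_sym; apply: commrM.
  - by apply: commrX; apply: commr_sym; apply: commrX.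
  - exact: c1.
  - by apply: commr_sym; exact: c1.
  - by apply: commrX; apply: commr_sym; apply: commrX.
by rewrite /bern -!scalerAl -!scalerAr c2 !scalerA mulrC.
Qed.

Lemma bern_pos x n k : pos x -> pos (1 - x) -> pos (bern x n k).
Proof.
move=> p0 p1; apply: posZ => //; apply: posM; [exact: pos_exp|exact: pos_exp|].
by apply/commrX/commr_sym/commrX/commr_sym/comm_onem.
Qed.

Lemma bern_sum x n : \sum_(k < n.+1) bern x n k = 1.
Proof.
transitivity (((1 - x) + x) ^+ n); last by rewrite subrK expr1n.
rewrite (exprDn_comm n (@comm_onem x)).
by apply: eq_bigr => k _; rewrite /bern scale_natE.
Qed.

(** The absorption identity k C(n+1, k) = (n+1) C(n, k-1): a factor k in the weights is traded for a
    factor x in degree one less. It yields the first two moments of the binomial distribution with x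
    as success probability. *)
Lemma bern_factor x n (g : nat -> R) :
  \sum_(k < n.+2) (k%:R * g k)%:C *: bern x n.+1 k =
  n.+1%:R%:C *: ((\sum_(j < n.+1) (g j.+1)%:C *: bern x n j) * x).
Proof.
rewrite big_ord_recl mul0r scale0r add0r mulr_suml scaler_sumr.
apply: eq_bigr => j _; rewrite /bern lift0 subSS -!scalerAl -mulrA -exprSr !scalerA.
rewrite -!rmorphM/=; congr (_%:C *: _).
rewrite mulrAC -natrM -mul_bin_diag natrM; ring.
Qed.

Lemma bern_mean x n : \sum_(k < n.+2) (k%:R / n.+1%:R)%:C *: bern x n.+1 k = x.
Proof.
rewrite (bern_factor x n (fun=> n.+1%:R^-1)) -scaler_sumr bern_sum -scalerAl mul1r.
by rewrite scalerA -rmorphM/= divff ?pnatr_eq0// scale1r.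
Qed.

Lemma bern_sqr x n : \sum_(k < n.+2) ((k%:R / n.+1%:R) ^+ 2)%:C *: bern x n.+1 k =
  x * x + n.+1%:R^-1%:C *: ((1 - x) * x).
Proof.
have n0 : n.+1%:R != 0 :> R by rewrite pnatr_eq0.
under eq_bigr do rewrite expr2 -mulrA.
rewrite (bern_factor x n (fun k => n.+1%:R^-1 * (k%:R / n.+1%:R))).
have -> : \sum_(j < n.+1) (n.+1%:R^-1 * (j.+1%:R / n.+1%:R) : R)%:C *: bern x n j =
   (n.+1%:R^-1 * n.+1%:R^-1)%:C *: (\sum_(j < n.+1) (j%:R : R)%:C *: bern x n j + 1).
  rewrite -(bern_sum x n) -big_split/= scaler_sumr; apply: eq_bigr => j _.
  rewrite -{3}[bern x n j]scale1r -(rmorph1 (real_complex R)) -scalerDl scalerA -rmorphD -rmorphM; congr (_%:C *: _).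
  by rewrite /= -natr1; ring.
have -> : \sum_(j < n.+1) (j%:R : R)%:C *: bern x n j = n%:R%:C *: x.
  (* Degree 0 is separate because [bern_mean] concerns positive degrees. *)
  case: n {n0} => [|n]; first by rewrite big_ord_recl big_ord0 scale0r addr0 scale0r.
  rewrite -[X in _ *: X](bern_mean x n) scaler_sumr; apply: eq_bigr => k _.
  rewrite scalerA -rmorphM/=; congr (_%:C *: _); rewrite mulrC divfK ?pnatr_eq0//.
rewrite -scalerAl scalerA -rmorphM/= mulrA divff// mul1r mulrDl mul1r -scalerAl.
rewrite scalerDr scalerA -rmorphM/=.
have -> : n.+1%:R^-1 * n%:R = 1 - n.+1%:R^-1 :> R.
  by apply: (mulfI n0); rewrite mulrA mulrBr divff// mul1r mulr1 -natr1 addrK.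
by rewrite rmorphB scalerBl scale1r mulrBl mul1r scalerBr addrAC -addrA.
Qed.

End Bernstein.

(** * Quantitative uniform continuity on [0, 1] *)

Section ComplexNorm.
Variable R : realType.
Implicit Types (r s t e : R) (z w : R[i]) (f g : R -> R[i]).

Definition cnorm z : R := complex.Re `|z|.

Lemma cnormE z : `|z| = (cnorm z)%:C.
Proof. by rewrite /cnorm RRe_real// normr_real. Qed.

Lemma cnorm_ge0 z : 0 <= cnorm z.
Proof. by rewrite -ler0c -cnormE. Qed.

Lemma cnormD z w : cnorm (z + w) <= cnorm z + cnorm w.
Proof. by rewrite -lecR rmorphD/= -!cnormE ler_normD. Qed.

Lemma cnormM z w : cnorm (z * w) = cnorm z * cnorm w.
Proof. by apply: complexI; rewrite rmorphM/= -!cnormE normrM. Qed.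

Lemma cnormN z : cnorm (- z) = cnorm z.
Proof. by rewrite /cnorm normrN. Qed.

Lemma cnormr r : cnorm r%:C = `|r|.
Proof. by rewrite /cnorm normc_def/= expr0n addr0 sqrtr_sqr. Qed.

Lemma cnormJ z : cnorm (conjc z) = cnorm z.
Proof. by rewrite /cnorm !normc_def; case: z => a b /=; rewrite sqrrN. Qed.

Lemma Re_le_cnorm z : `|complex.Re z| <= cnorm z.
Proof.
rewrite /cnorm normc_def/= -sqrtr_sqr ler_wsqrtr// lerDl; exact: sqr_ge0.
Qed.

Lemma Im_le_cnorm z : `|complex.Im z| <= cnorm z.
Proof.
rewrite /cnorm normc_def/= -sqrtr_sqr ler_wsqrtr// lerDr; exact: sqr_ge0.
Qed.

(* Uniform continuity on [0, 1], in the quantitative form used in Bernstein's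
   proof of the Weierstrass theorem. *)
Definition ucont f := forall e, 0 < e -> exists2 C, 0 <= C &
  forall s t, 0 <= s <= 1 -> 0 <= t <= 1 -> cnorm (f s - f t) <= e + C * (s - t) ^+ 2.

Lemma ucont_bounded f : ucont f -> exists2 M, 0 < M & forall s, 0 <= s <= 1 -> cnorm (f s) <= M.
Proof.
move=> /(_ 1 ltr01)[C C0 hC]; have f0 := cnorm_ge0 (f 0).
exists (1 + C + cnorm (f 0)); first by lra.
move=> s s01; have := hC s 0 s01; rewrite lexx ler01 subr0 => /(_ isT) h.
have := cnormD (f s - f 0) (f 0); rewrite subrK.
case/andP: s01 => s0 s1; have s2 : s ^+ 2 <= 1 by nra.
by have := ler_wpM2l C0 s2; lra.
Qed.

Lemma ucont_cst z : ucont (fun=> z).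
Proof.
move=> e e0; exists 0 => // s t _ _; rewrite subrr mul0r addr0.
by rewrite (cnormr 0) normr0 ltW.
Qed.

Lemma ucont_id : ucont (fun s => s%:C).
Proof.
(* For u = |s - t|, the bound u <= e + u^2 / e follows from e u <= e^2 + u^2. *)
move=> e e0; exists e^-1; first by rewrite invr_ge0 ltW.
move=> s t _ _; rewrite -rmorphB cnormr.
rewrite -(@ler_pM2l _ e)// mulrDr mulrA divff ?gt_eqF// mul1r.
have <- : `|s - t| ^+ 2 = (s - t) ^+ 2 by rewrite real_normK ?num_real.
by set u := `|s - t|; have := sqr_ge0 (e - u); have := sqr_ge0 (e + u); nra.
Qed.

Lemma ucontD f g : ucont f -> ucont g -> ucont (fun s => f s + g s).
Proof.
move=> hf hg e e0; have e20 : 0 < e / 2 by lra.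
have [C C0 fC] := hf _ e20; have [D D0 gD] := hg _ e20.
exists (C + D); first exact: addr_ge0.
move=> s t s01 t01; rewrite opprD addrACA; apply: (le_trans (cnormD _ _)).
have := fC _ _ s01 t01; have := gD _ _ s01 t01; lra.
Qed.

Lemma ucontM f g : ucont f -> ucont g -> ucont (fun s => f s * g s).
Proof.
move=> hf hg e e0; have [M M0 fM] := ucont_bounded hf; have [N N0 gN] := ucont_bounded hg.
have [C C0 fC] := hf _ (divr_gt0 e0 (addr_gt0 N0 N0)).
have [D D0 gD] := hg _ (divr_gt0 e0 (addr_gt0 M0 M0)).
exists (N * C + M * D); first by rewrite addr_ge0// mulr_ge0// ltW.
move=> s t s01 t01.
have -> : f s * g s - f t * g t = f s * (g s - g t) + (f s - f t) * g t by ring.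
apply: (le_trans (cnormD _ _)); rewrite !cnormM.
have h1 := fC _ _ s01 t01; have h2 := gD _ _ s01 t01.
have h3 := fM _ s01; have h4 := gN _ t01.
have k1 : cnorm (f s) * cnorm (g s - g t) <= M * (e / (M + M) + D * (s - t) ^+ 2).
  by apply: ler_pM => //; exact: cnorm_ge0.
have k2 : cnorm (f s - f t) * cnorm (g t) <= (e / (N + N) + C * (s - t) ^+ 2) * N.
  by apply: ler_pM => //; exact: cnorm_ge0.
apply: (le_trans (lerD k1 k2)); rewrite le_eqVlt; apply/orP; left; apply/eqP.
field; apply/andP; split; apply: lt0r_neq0; lra.
Qed.

Lemma ucontZ z f : ucont f -> ucont (fun s => z * f s).
Proof. by apply: ucontM; exact: ucont_cst. Qed.

Lemma ucontB f g : ucont f -> ucont g -> ucont (fun s => f s - g s).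
Proof.
move=> hf /(ucontZ (-1)) hg; have := ucontD hf hg.
by congr ucont; apply/funext => s; rewrite mulN1r.
Qed.

Lemma ucont_onem f : ucont f -> ucont (fun s => f (1 - s)).
Proof.
move=> hf e /hf[C C0 fC]; exists C => // s t /andP[? ?] /andP[? ?].
have -> : (s - t) ^+ 2 = ((1 - s) - (1 - t)) ^+ 2 by ring.
by apply: fC; lra.
Qed.

Lemma inv_small e : 0 < e -> exists N, forall n, (N <= n)%N -> n.+1%:R^-1 <= e.
Proof.
move=> e0; have ei : 0 <= e^-1 by rewrite invr_ge0 ltW.
exists (Num.bound e^-1) => n Nn; rewrite -[leRHS]invrK lef_pV2 ?posrE ?invr_gt0//.
by apply: ltW; apply: (lt_le_trans (archi_boundP ei)); rewrite ler_nat leqW.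
Qed.

End ComplexNorm.

(** * Bernstein operators in one and two variables *)

Section Calculus.
Variables (R : realType) (A : unitalCstarType R) (A1 : sone != 0 :> A).
Local Notation T := (calg A1).
Implicit Types (r s t e C : R) (f g : R -> R[i]) (F G : R -> R -> R[i]).

(** The index n stands for degree n + 1, so that the denominator never vanishes. *)
Definition node n k : R := k%:R / n.+1%:R.

Lemma node_itv n (k : 'I_n.+2) : 0 <= node n k <= 1.
Proof.
rewrite divr_ge0// ler_pdivrMr ?ltr0n// mul1r ler_nat.
by rewrite -ltnS ltn_ord.
Qed.

Definition Bern (x : T) n f : T := \sum_(k < n.+2) f (node n k) *: bern x n.+1 k.

Lemma eq_Bern x n f g : (forall s, 0 <= s <= 1 -> f s = g s) -> Bern x n f = Bern x n g.
Proof. by move=> fg; apply: eq_bigr => k _; rewrite fg// node_itv. Qed.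

Lemma Bern1 x n : Bern x n (fun=> 1) = 1.
Proof. by rewrite -[RHS](bern_sum x n.+1); apply: eq_bigr => k _; rewrite scale1r. Qed.

Lemma Bern_id x n : Bern x n (fun s => s%:C) = x.
Proof. exact: bern_mean. Qed.

Lemma Bern_sqr x n : Bern x n (fun s => (s ^+ 2)%:C) = x * x + n.+1%:R^-1%:C *: ((1 - x) * x).
Proof. exact: bern_sqr. Qed.

Lemma BernD x n f g : Bern x n (fun s => f s + g s) = Bern x n f + Bern x n g.
Proof. by rewrite -big_split/=; apply: eq_bigr => k _; rewrite scalerDl. Qed.

Lemma BernZ x n (c : R[i]) f : Bern x n (fun s => c * f s) = c *: Bern x n f.
Proof. by rewrite scaler_sumr; apply: eq_bigr => k _; rewrite scalerA. Qed.

Section PositiveContraction.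
Variable x : T.
Hypotheses (x0 : pos x) (x1 : pos (1 - x)).

(** The two-variable operator expresses both Bern_n f - Bern_m f and Bern_n (f g) - Bern_n f Bern_n
    g as the image of a function vanishing on the diagonal. Convergence and multiplicativity thus
    follow from the single estimate [Bern2_small]. *)
Definition Bern2 n m F : T :=
  \sum_(k < n.+2) \sum_(l < m.+2) F (node n k) (node m l) *: (bern x n.+1 k * bern x m.+1 l).

Lemma eq_Bern2 n m F G : (forall s t, F s t = G s t) -> Bern2 n m F = Bern2 n m G.
Proof. by move=> FG; congr Bern2; apply/funext => s; apply/funext => t. Qed.

Lemma Bern2_tensor n m f g : Bern2 n m (fun s t => f s * g t) = Bern x n f * Bern x m g.
Proof.
rewrite mulr_suml; apply: eq_bigr => k _; rewrite mulr_sumr; apply: eq_bigr => l _.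
move: (bern x n.+1 k) (bern x m.+1 l) => b c.
by rewrite -scalerAl -scalerAr scalerA.
Qed.

Lemma Bern2D n m F G : Bern2 n m (fun s t => F s t + G s t) = Bern2 n m F + Bern2 n m G.
Proof.
rewrite -big_split/=; apply: eq_bigr => k _; rewrite -big_split/=.
by apply: eq_bigr => l _; rewrite scalerDl.
Qed.

Lemma Bern2Z n m (c : R[i]) F : Bern2 n m (fun s t => c * F s t) = c *: Bern2 n m F.
Proof.
rewrite scaler_sumr; apply: eq_bigr => k _; rewrite scaler_sumr.
by apply: eq_bigr => l _; rewrite scalerA.
Qed.

Lemma Bern2_cst n m (c : R[i]) : Bern2 n m (fun _ _ => c) = c%:A.
Proof.
have <- : Bern2 n m (fun _ _ => c * (1 * 1)) = c%:A.
  by rewrite Bern2Z (Bern2_tensor n m (fun=> 1) (fun=> 1)) !Bern1 mulr1.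
by apply: eq_Bern2 => s t; rewrite !mulr1.
Qed.

Lemma Bern2_sqrdist n m : Bern2 n m (fun s t => ((s - t) ^+ 2)%:C) =
  (n.+1%:R^-1 + m.+1%:R^-1)%:C *: ((1 - x) * x).
Proof.
transitivity (Bern2 n m (fun s t => ((s ^+ 2)%:C * 1 + 1 * (t ^+ 2)%:C) + -2 * (s%:C * t%:C))).
  apply: eq_Bern2 => s t; rewrite !rmorphXn rmorphB/=; ring.
rewrite !Bern2D (Bern2Z n m (-2) (fun s t => s%:C * t%:C)).
rewrite (Bern2_tensor n m (fun s => (s ^+ 2)%:C) (fun=> 1)).
rewrite (Bern2_tensor n m (fun=> 1) (fun s => (s ^+ 2)%:C)).
rewrite (Bern2_tensor n m (fun s => s%:C) (fun s => s%:C)) !Bern1 !Bern_sqr !Bern_id mul1r mulr1.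
rewrite scaleNr (_ : (2 : R[i]) *: (x * x) = x * x + x * x); last by rewrite scaler_nat mulr2n.
by rewrite addrACA [X in X - _]addrC addrK -scalerDl -rmorphD.
Qed.

Lemma Bern2_pos n m (G : R -> R -> R) :
  (forall s t, 0 <= s <= 1 -> 0 <= t <= 1 -> 0 <= G s t) ->
  pos (Bern2 n m (fun s t => (G s t)%:C)).
Proof.
move=> G0; apply: pos_sum => k; apply: pos_sum => l; apply: posZ.
  by apply: G0; exact: node_itv.
by apply: posM; [exact: bern_pos|exact: bern_pos|exact: bern_comm].
Qed.

Lemma Bern2_sa n m (G : R -> R -> R) : adj (Bern2 n m (fun s t => (G s t)%:C)) = Bern2 n m (fun s t => (G s t)%:C).
Proof.
(* Positive part minus negative part; [Bern2] makes each of them positive, hence self-adjoint. *)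
have P s t : G s t = Num.max (G s t) 0 + -1 * Num.max (- G s t) 0.
  by case: (lerP (G s t) 0); case: (lerP (- G s t) 0); lra.
rewrite (@eq_Bern2 n m _ (fun s t => (Num.max (G s t) 0)%:C + (-1)%:C * (Num.max (- G s t) 0)%:C)).
  rewrite Bern2D Bern2Z adjD adjZr !(pos_sa (@Bern2_pos _ _ _ _))// => s t _ _.
    by rewrite le_max lexx orbT.
  by rewrite le_max lexx orbT.
by move=> s t; rewrite -rmorphM -rmorphD/= -P.
Qed.

Let K : R := nrm ((1 - x) * x).

(** By positivity, the images of G and -G are at most e + C D, where D is the image of (s - t)^2.
    The variance formula bounds D in norm, and [nrm_le_of_pos] turns the two order bounds into a
    norm bound. *)
Lemma Bern2_bound_real n m (G : R -> R -> R) e C : 0 <= e -> 0 <= C ->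
  (forall s t, 0 <= s <= 1 -> 0 <= t <= 1 -> `|G s t| <= e + C * (s - t) ^+ 2) ->
  nrm (Bern2 n m (fun s t => (G s t)%:C)) <= e + C * (n.+1%:R^-1 + m.+1%:R^-1) * K.
Proof.
move=> e0 C0 hG; set d := _ + m.+1%:R^-1.
have d0 : 0 <= d by rewrite addr_ge0// invr_ge0.
have K0 : 0 <= K := nrm_ge0 _.
pose D := Bern2 n m (fun s t => ((s - t) ^+ 2)%:C).
have nD : nrm (C%:C *: D) <= C * d * K.
  by rewrite /D Bern2_sqrdist scalerA -rmorphM nrmZr ger0_norm// mulr_ge0.
have pD : pos ((C * d * K)%:C%:A - C%:C *: D).
  by apply: pos_sub => //; rewrite adjZr Bern2_sa.
have key (H : R -> R -> R) :
    (forall s t, 0 <= s <= 1 -> 0 <= t <= 1 -> `|H s t| <= e + C * (s - t) ^+ 2) ->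
    pos ((e + C * d * K)%:C%:A - Bern2 n m (fun s t => (H s t)%:C)).
  move=> hH; have := posD pD (@Bern2_pos n m (fun s t => e + C * (s - t) ^+ 2 - H s t) _).
  have -> : Bern2 n m (fun s t => (e + C * (s - t) ^+ 2 - H s t)%:C) =
      (e%:C%:A + C%:C *: D) - Bern2 n m (fun s t => (H s t)%:C).
    rewrite -scaleN1r -(Bern2_cst n m) -!Bern2Z -!Bern2D; apply: eq_Bern2 => s t.
    by rewrite mulN1r -rmorphM -rmorphD -rmorphB.
  rewrite addrA [e%:C%:A + _]addrC [X in X - _]addrA subrK -scalerDl -rmorphD/= => h.
  by rewrite (addrC e); apply: h => s t s01 t01; have := hH s t s01 t01; rewrite ler_norml; lra.
apply: nrm_le_of_pos; first exact: Bern2_sa.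
- by rewrite addr_ge0// mulr_ge0// mulr_ge0.
- exact: key.
- have := key (fun s t => - G s t).
  rewrite (_ : Bern2 n m (fun s t => (- G s t)%:C) = - Bern2 n m (fun s t => (G s t)%:C)).
    by rewrite opprK; apply => s t s01 t01; rewrite normrN; exact: hG.
  by rewrite -scaleN1r -Bern2Z; apply: eq_Bern2 => s t; rewrite mulN1r rmorphN.
Qed.

Lemma Bern2_bound n m F e C : 0 <= e -> 0 <= C ->
  (forall s t, 0 <= s <= 1 -> 0 <= t <= 1 -> cnorm (F s t) <= e + C * (s - t) ^+ 2) ->
  nrm (Bern2 n m F) <= 2 * (e + C * (n.+1%:R^-1 + m.+1%:R^-1) * K).
Proof.
move=> e0 C0 hF.
have -> : Bern2 n m F = Bern2 n m (fun s t => (complex.Re (F s t))%:C) +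
    'i%C *: Bern2 n m (fun s t => (complex.Im (F s t))%:C).
  by rewrite -Bern2Z -Bern2D; apply: eq_Bern2 => s t; exact: complexE.
apply: (le_trans (nrmD _ _)); rewrite nrmZ.
have -> : complex.Re `|('i%C : R[i])| = 1 by rewrite normc_def/= expr0n expr1n add0r sqrtr1.
rewrite mul1r; set W := e + _.
have hRe : nrm (Bern2 n m (fun s t => (complex.Re (F s t))%:C)) <= W.
  apply: Bern2_bound_real => // s t s01 t01.
  by apply: le_trans (hF _ _ s01 t01); exact: Re_le_cnorm.
have hIm : nrm (Bern2 n m (fun s t => (complex.Im (F s t))%:C)) <= W.
  apply: Bern2_bound_real => // s t s01 t01.
  by apply: le_trans (hF _ _ s01 t01); exact: Im_le_cnorm.
lra.
Qed.

Lemma Bern2_small F :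
  (forall e, 0 < e -> exists2 C, 0 <= C & forall s t, 0 <= s <= 1 -> 0 <= t <= 1 ->
     cnorm (F s t) <= e + C * (s - t) ^+ 2) ->
  forall e, 0 < e -> exists N, forall n m, (N <= n)%N -> (N <= m)%N -> nrm (Bern2 n m F) <= e.
Proof.
(* In [Bern2_bound] this contributes e / 2. Degrees with 1 / (n + 1) <= e / (8CK + 1) bound the
   other term by 4CK e / (8CK + 1) <= e / 2. *)
move=> hF e e0; have e40 : 0 < e / 4 by lra.
have [C C0 hC] := hF _ e40; have K0 : 0 <= K := nrm_ge0 _.
have L0 : 0 < 8 * (C * K) + 1 by have := mulr_ge0 C0 K0; lra.
have [N hN] := inv_small (divr_gt0 e0 L0); exists N => n m /hN hn /hN hm.
apply: (le_trans (Bern2_bound n m (ltW e40) C0 hC)).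
have CK := mulr_ge0 C0 K0; set a := n.+1%:R^-1 in hn *; set b := m.+1%:R^-1 in hm *.
have E : e / (8 * (C * K) + 1) * (8 * (C * K) + 1) = e by rewrite divfK// gt_eqF.
set q := e / _ in hn hm E.
have q0 : 0 <= q by apply: divr_ge0; apply: ltW.
have -> : C * (a + b) * K = (C * K) * (a + b) by ring.
have := ler_wpM2l CK (lerD hn hm); nra.
Qed.

Lemma Bern_cauchy f : ucont f -> exists y, tends (fun n => Bern x n f) y.
Proof.
move=> hf; apply: cauchy_tends => e /(Bern2_small hf)[N hN]; exists N => n m Nn Nm.
have -> : Bern x n f - Bern x m f = Bern2 n m (fun s t => f s - f t).
  transitivity (Bern2 n m (fun s t => f s * 1 + (-1) * (1 * f t))).
    rewrite Bern2D (Bern2Z n m (-1) (fun s t => 1 * f t)) (Bern2_tensor n m f (fun=> 1)) (Bern2_tensor n m (fun=> 1) f).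
    by rewrite !Bern1 mulr1 mul1r scaleN1r.
  by apply: eq_Bern2 => s t; rewrite mulr1 mul1r mulN1r.
exact: hN.
Qed.

End PositiveContraction.
End Calculus.

(** * Continuous functional calculus *)

Section FunctionalCalculus.
Variables (R : realType) (A : unitalCstarType R) (A1 : sone != 0 :> A).
Local Notation T := (calg A1).
Implicit Types (x y : T) (r s t e C : R) (f g : R -> R[i]).

(** The default 0 does not occur for [ucont] functions when [x] and 1 - [x] are positive, by
    [fcalcP]. *)
Definition fcalc x f : T := xget 0 [set y | tends (fun n => Bern x n f) y].

Lemma fcalc_lim x f y : tends (fun n => Bern x n f) y -> fcalc x f = y.
Proof. by move=> fy; apply: (tends_uniq _ fy); exact: (xgetI 0 fy). Qed.

Lemma eq_fcalc x f g : (forall s, 0 <= s <= 1 -> f s = g s) -> fcalc x f = fcalc x g.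
Proof.
move=> fg; rewrite /fcalc (_ : (fun n => Bern x n f) = (fun n => Bern x n g))//.
by apply/funext => n; exact: eq_Bern.
Qed.

(** The symmetry k |-> n + 1 - k of the Bernstein basis. It is the source of equivariance, since the
    nontrivial element of Z/2 sends x to 1 - x. *)
Lemma Bern_onem x n f : Bern (1 - x) n f = Bern x n (fun s => f (1 - s)).
Proof.
rewrite /Bern (reindex_inj rev_ord_inj); apply: eq_bigr => k _ /=.
have kn : (k <= n.+1)%N by rewrite -ltnS ltn_ord.
rewrite subSS; congr (_ *: _).
  congr f; rewrite /node natrB// mulrBl divff ?pnatr_eq0//.
rewrite /bern subKn// bin_sub// opprB addrC subrK; congr (_ *: _).
by apply/commrX/commr_sym/commrX; rewrite /GRing.comm mulrBl mulrBr mul1r mulr1.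
Qed.

Lemma fcalc_onem x f : fcalc (1 - x) f = fcalc x (fun s => f (1 - s)).
Proof.
rewrite /fcalc (_ : (fun n => Bern (1 - x) n f) = (fun n => Bern x n (fun s => f (1 - s))))//.
by apply/funext => n; exact: Bern_onem.
Qed.

Section PositiveContraction.
Variable x : T.
Hypotheses (x0 : pos x) (x1 : pos (1 - x)).

Lemma fcalcP f : ucont f -> tends (fun n => Bern x n f) (fcalc x f).
Proof. by move=> /(Bern_cauchy x0 x1)[y fy]; rewrite (fcalc_lim fy). Qed.

Lemma fcalcD f g : ucont f -> ucont g ->
  fcalc x (fun s => f s + g s) = fcalc x f + fcalc x g.
Proof.
move=> hf hg; apply: fcalc_lim; have := tendsD (fcalcP hf) (fcalcP hg).
by congr tends; apply/funext => n; rewrite BernD.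
Qed.

Lemma fcalcZ (c : R[i]) f : ucont f -> fcalc x (fun s => c * f s) = c *: fcalc x f.
Proof.
move=> hf; apply: fcalc_lim; have := tendsZ c (fcalcP hf).
by congr tends; apply/funext => n; rewrite BernZ.
Qed.

Lemma fcalc_cst (c : R[i]) : fcalc x (fun=> c) = c%:A.
Proof.
apply: fcalc_lim; rewrite (_ : (fun n => _) = fun=> c%:A); first exact: tends_cst.
apply/funext => n; rewrite -(Bern1 x n) -BernZ; apply: eq_Bern => s _.
by rewrite mulr1.
Qed.

Lemma fcalc_id : fcalc x (fun s => s%:C) = x.
Proof.
apply: fcalc_lim; rewrite (_ : (fun n => _) = fun=> x); first exact: tends_cst.
by apply/funext => n; rewrite Bern_id.
Qed.

Lemma fcalcB f g : ucont f -> ucont g ->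
  fcalc x (fun s => f s - g s) = fcalc x f - fcalc x g.
Proof.
move=> hf hg; rewrite -scaleN1r -fcalcZ// -fcalcD//; last exact: ucontZ.
by apply: eq_fcalc => s _; rewrite mulN1r.
Qed.

Lemma fcalcJ f : ucont f -> fcalc x (fun s => conjc (f s)) = adj (fcalc x f).
Proof.
move=> hf; apply: fcalc_lim; have := tends_adj (fcalcP hf).
congr tends; apply/funext => n; rewrite /Bern.
elim/big_ind2: _ => [|y a z b <- <-|k _]; [exact: adj0|exact: adjD|].
by rewrite adjZ (pos_sa (bern_pos _ _ x0 x1)).
Qed.

Lemma fcalcM f g : ucont f -> ucont g ->
  fcalc x (fun s => f s * g s) = fcalc x f * fcalc x g.
Proof.
move=> hf hg; apply: fcalc_lim.
apply: (tends_dist0 (tendsM (fcalcP hf) (fcalcP hg))) => e e0.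
have [M M0 fM] := ucont_bounded hf.
have [|N hN] := @Bern2_small _ _ _ x x0 x1 (fun s t => f s * (g s - g t)) _ e e0.
  move=> d d0; have [C C0 hC] := hg _ (divr_gt0 d0 M0).
  exists (M * C); first by rewrite mulr_ge0// ltW.
  move=> s t s01 t01; rewrite cnormM.
  apply: (@le_trans _ _ (M * (d / M + C * (s - t) ^+ 2))).
    by apply: ler_pM; rewrite ?cnorm_ge0 ?fM ?hC.
  by rewrite mulrDr mulrCA divff ?gt_eqF// mulr1 mulrA.
exists N => n Nn; rewrite subr0.
have -> : Bern x n (fun s => f s * g s) - Bern x n f * Bern x n g =
    Bern2 x n n (fun s t => f s * (g s - g t)).
  transitivity (Bern2 x n n (fun s t => f s * g s * 1 + (-1) * (f s * g t))).
    rewrite Bern2D (Bern2Z x n n (-1) (fun s t => f s * g t)) (Bern2_tensor x n n f g).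
    by rewrite (Bern2_tensor x n n (fun s => f s * g s) (fun=> 1)) Bern1 mulr1 scaleN1r.
  by apply: eq_Bern2 => s t; rewrite mulr1 mulN1r mulrBr.
exact: hN.
Qed.

Lemma fcalc_pos (f : R -> R) M : ucont (fun s => (f s)%:C) ->
  (forall s, 0 <= s <= 1 -> 0 <= f s <= M) -> pos (fcalc x (fun s => (f s)%:C)).
Proof.
move=> hf fM; have M0 : 0 <= M.
  have := fM 0; rewrite lexx ler01 => /(_ isT)/andP[]; exact: le_trans.
have Bpos n (g : R -> R) : (forall s, 0 <= s <= 1 -> 0 <= g s) ->
    pos (Bern x n (fun s => (g s)%:C)).
  move=> g0; apply: pos_sum => k; apply: posZ; last exact: bern_pos.
  by apply: g0; exact: node_itv.
have BB n (g : R -> R) : Bern x n (fun s => (M - g s)%:C) = M%:C%:A - Bern x n (fun s => (g s)%:C).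
  rewrite -scaleN1r -(Bern1 x n) -!BernZ -BernD; apply: eq_Bern => s _.
  by rewrite rmorphB/= mulr1 mulN1r.
split.
  rewrite -fcalcJ//; apply: eq_fcalc => s _; exact: conjc_real.
(* The same M serves all degrees, so the norm inequality in [pos] passes to the limit. *)
exists M => //; apply: (tends_nrm_le (tendsB (tends_cst _) (fcalcP hf))) => n.
rewrite -BB; apply: nrm_le_of_pos => //.
- by apply: pos_sa; apply: Bpos => s /fM/andP[_]; rewrite subr_ge0.
- rewrite -BB; apply: Bpos => s /fM/andP[]; lra.
- rewrite (_ : _ + _ = M%:C%:A + Bern x n (fun s => (M - f s)%:C))//.
  apply: posD; first exact: pos_scalar.
  by apply: Bpos => s /fM/andP[]; lra.
Qed.

End PositiveContraction.
End FunctionalCalculus.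

Section CalculusNaturality.
Variables (R : realType) (A B : unitalCstarType R).
Variables (A1 : sone != 0 :> A) (B1 : sone != 0 :> B).

(** [h] maps Bernstein polynomials of x to those of h x, and its contractivity carries the limit
    along. *)
Lemma fcalc_hom (h : calg A1 -> calg B1) (x : calg A1) (f : R -> R[i]) :
  star_hom (h : A -> B) -> h 1 = 1 -> pos x -> pos (1 - x) -> ucont f ->
  h (fcalc x f) = fcalc (h x) f.
Proof.
move=> hh h1 x0 x1 uf; apply/esym/fcalc_lim => e /(fcalcP x0 x1 uf)[N hN].
have hD y z : h (y + z) = h y + h z := star_homD hh y z.
have hM y z : h (y * z) = h y * h z := star_homM hh y z.
have hZ (c : R[i]) y : h (c *: y) = c *: h y by exact: star_homZ hh c y.
have hB y z : h (y - z) = h y - h z by rewrite -scaleN1r hD hZ scaleN1r.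
have hX y n : h (y ^+ n) = h y ^+ n by elim: n => [|n ih]; rewrite ?h1// !exprS hM ih.
exists N => n /hN; apply: le_trans.
have -> : Bern (h x) n f = h (Bern x n f).
  rewrite /Bern; elim/big_ind2: _ => [|y a z b -> ->|k _].
  - by apply/esym/(star_hom0 hh).
  - by rewrite hD.
  - by rewrite hZ /bern hZ hM !hX hB h1.
by rewrite -hB; exact: star_hom_contractive.
Qed.

End CalculusNaturality.

(** * Functions on (0, 1] x Z/2 *)

Definition flip : Z2 := (1%R : 'Z_2).

Section Folding.
Variable R : realType.
Implicit Types (F H : C0 R (unitIoc R * Z2)%type) (g : Z2) (r s t u e : R).

Lemma unitIocP (s : unitIoc R) : 0 < \val s <= 1.
Proof. by case: s => s /= /set_mem. Qed.

Definition mkIoc s (s01 : 0 < s <= 1) : unitIoc R :=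
  exist _ s (mem_set (s01 : [set x : R | 0 < x <= 1] s)).

Definition ext F g s : R[i] :=
  if pselect (0 < s <= 1) is left s01 then F (mkIoc s01, g) else 0.

Lemma ext_val F g (p : unitIoc R) : ext F g (\val p) = F (p, g).
Proof.
rewrite /ext; case: pselect => [s01|/(_ (unitIocP p))//].
by congr (F (_, g)); exact: val_inj.
Qed.

Lemma ext_out F g s : ~ (0 < s <= 1) -> ext F g s = 0.
Proof. by rewrite /ext; case: pselect. Qed.

Lemma ext_bounded F g : exists2 M, 0 < M & forall s, cnorm (ext F g s) <= M.
Proof.
have [M M0 hM] := C0_bounded F.
have ME : M = (complex.Re M)%:C by rewrite RRe_real// gtr0_real.
exists (complex.Re M); first by rewrite -(ltcR 0) -ME.
move=> s; rewrite -lecR -cnormE -ME /ext; case: pselect => [s01|_]; first exact: ltW.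
by rewrite normr0 ltW.
Qed.

(** Only points up to 1 are compared, as the extension by zero may jump at 1. Continuity at 0 is
    where vanishing at infinity on (0, 1] enters. *)
Lemma ext_continuous F g s e : s <= 1 -> 0 < e ->
  exists2 d, 0 < d & forall t, t <= 1 -> `|s - t| < d -> cnorm (ext F g s - ext F g t) <= e.
Proof.
move=> s1 e0; have eC : 0 < e%:C :> R[i] by rewrite (ltcR 0).
have [cF F0] := C0P F; have [s0|s0] := ltP 0 s.
  have s01 : 0 < s <= 1 by rewrite s0.
  have [[V W] /= [[_ [[U oU <-] /= Us UV]] /nbhs_singleton Wg] VW] := cF (mkIoc s01, g) _
    (nbhsx_ballx (F (mkIoc s01, g) : R[i]^o) e%:C eC).
  have /nbhs_ballP[d /= d0 dU] : nbhs s U by exact: open_nbhs_nbhs.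
  exists (Num.min d s); first by rewrite lt_min d0.
  move=> t t1; rewrite lt_min => /andP[st1 st2].
  have t01 : 0 < t <= 1 by rewrite t1 andbT; move: st2; rewrite ltr_norml => /andP[_]; lra.
  rewrite -[s]/(\val (mkIoc s01)) -[t]/(\val (mkIoc t01)) !ext_val.
  have : (V `*` W) (mkIoc t01, g).
    by split=> //=; apply: UV; apply: dU; rewrite /= -ball_normE.
  by move=> /VW /=; rewrite -ball_normE /= cnormE ltcR => /ltW.
have nIoc (q : R) : q <= 0 -> ~ (0 < q <= 1) by move=> q0 /andP[]; lra.
(* A compact, hence closed, set of positive reals; its complement is a neighbourhood of s <= 0 on
   which the extension is small. *)
pose K := (fun p : unitIoc R * Z2 => \val p.1) @` [set p | e%:C <= `|F p|].
have cK : compact K.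
  apply: continuous_compact; last exact: F0.
  apply: continuous_subspaceT => p; apply: continuous_comp; first exact: cvg_fst.
  exact: initial_continuous.
have : nbhs s (~` K).
  apply: open_nbhs_nbhs; split; first by rewrite openC; apply: compact_closed.
  by move=> [p _ ps]; have := unitIocP p.1; rewrite ps => /andP[]; lra.
move=> /nbhs_ballP[d /= d0 dK]; exists d => // t t1 st.
rewrite (ext_out F g (nIoc _ s0)) sub0r cnormN.
have [t0|t0] := leP t 0.
  by rewrite (ext_out F g (nIoc _ t0)) (cnormr 0) normr0 ltW.
have t01 : 0 < t <= 1 by rewrite t0.
rewrite leNgt; apply/negP => ht.
apply: (dK t); first by rewrite /= -ball_normE.
exists (mkIoc t01, g) => //=; rewrite -ext_val/= cnormE lecR ltW//.
Qed.

Lemma segment_unif_continuous (f : R -> R[i]) a b :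
  (forall s e, a <= s <= b -> 0 < e -> exists2 d, 0 < d &
     forall t, a <= t <= b -> `|s - t| < d -> cnorm (f s - f t) <= e) ->
  forall e, 0 < e -> exists2 d, 0 < d & forall s t, a <= s <= b -> a <= t <= b ->
    `|s - t| < d -> cnorm (f s - f t) <= e.
Proof.
move=> fc e e0; have := @segment_compact R a b; rewrite compact_near_coveringP.
(* Compactness in near-covering form, along d -> 0+, turns moduli valid near each point into a
   uniform one. *)
pose P d s := a <= s <= b -> forall t, a <= t <= b -> `|s - t| < d -> cnorm (f s - f t) <= e.
have e20 : 0 < e / 2 by lra.
move=> /(_ _ (0 : R)^'+ P _) [|d [/= d0 dP]].
  move=> s /=; rewrite in_itv/= => sab; have [d d0 hd] := fc s _ sab e20.
  have d20 : 0 < d / 2 by lra.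
  exists (ball s (d / 2), [set r | r < d / 2]) => /=.
    by split; [exact: nbhsx_ballx|exact: nbhs_right_lt].
  move=> [s' r] /= []; rewrite -ball_normE /= => ss' rd s'ab t tab s't.
  have h1 := hd s' s'ab (lt_trans ss' _).
  have h2 : cnorm (f s - f t) <= e / 2.
    by apply: hd => //; have := ler_distD s' s t; lra.
  have -> : f s' - f t = - (f s - f s') + (f s - f t) by ring.
  by apply: (le_trans (cnormD _ _)); rewrite cnormN; have := h1 _; lra.
exists (d / 2); first by lra.
move=> s t sab tab st.
have := dP (d / 2); rewrite /= sub0r normrN ger0_norm; last by lra.
move=> /(_ _ _ s); apply => //; lra.
Qed.

Lemma ext_ucont F g : ucont (fun u => ext F g (2 * u - 1)).
Proof.
move=> e e0; have [M M0 hM] := ext_bounded F g.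
have [|d d0 hd] := @segment_unif_continuous (ext F g) (-1) 1 _ e e0.
  move=> s r /andP[_ s1] r0; have [d d0 hd] := ext_continuous F g s1 r0.
  by exists d => // t /andP[_]; exact: hd.
(* If the arguments of [ext] are at least d apart, then 4 (s - t)^2 >= d^2, and the quadratic term
   exceeds the trivial bound M + M. *)
exists ((M + M) * 4 / d ^+ 2).
  by rewrite divr_ge0 ?sqr_ge0//; lra.
move=> s t s01 t01; have [st|st] := ltP (`|(2 * s - 1) - (2 * t - 1)|) d.
  apply: (le_trans (hd _ _ _ _ st)); rewrite ?lerDl; [lra|lra|].
  by rewrite mulr_ge0 ?sqr_ge0// divr_ge0 ?sqr_ge0//; lra.
have MM : cnorm (ext F g (2 * s - 1) - ext F g (2 * t - 1)) <= M + M.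
  by apply: (le_trans (cnormD _ _)); rewrite cnormN lerD.
apply: (le_trans MM); apply: (@le_trans _ _ ((M + M) * 4 / d ^+ 2 * (s - t) ^+ 2)); last by lra.
have d2 : 0 < d ^+ 2 by rewrite exprn_gt0.
rewrite mulrAC ler_pdivlMr// -mulrA ler_wpM2l//; first by lra.
have d24 : d ^+ 2 <= 4 * (s - t) ^+ 2.
  have -> : 4 * (s - t) ^+ 2 = `|2 * s - 1 - (2 * t - 1)| ^+ 2.
    by rewrite real_normK ?num_real//; ring.
  by rewrite lerXn2r// nnegrE ltW.
exact: d24.
Qed.

(* A function on (0, 1] x Z/2 is a function on [-1, 1] vanishing at 0; it is
   composed with u |-> 2u - 1 to live on [0, 1]. *)
Definition fold F (u : R) : R[i] := ext F 1%g (2 * u - 1) + ext F flip (1 - 2 * u).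

Lemma fold_ucont F : ucont (fold F).
Proof.
apply: ucontD; first exact: ext_ucont.
have := ucont_onem (ext_ucont F flip); congr ucont.
by apply/funext => u; congr ext; ring.
Qed.

Lemma foldD F H u : fold (F + H) u = fold F u + fold H u.
Proof.
have E g s : ext (F + H) g s = ext F g s + ext H g s.
  by rewrite /ext; case: pselect => // _; rewrite addr0.
by rewrite /fold !E addrACA.
Qed.

Lemma foldZ (c : R[i]) F u : fold (c *: F) u = c * fold F u.
Proof.
have E g s : ext (c *: F) g s = c * ext F g s.
  by rewrite /ext; case: pselect => // _; rewrite mulr0.
by rewrite /fold !E mulrDr.
Qed.

(** At each u one of the two summands of [fold] vanishes, so there are no cross terms. *)
Lemma foldM F H u : fold (smul F H) u = fold F u * fold H u.
Proof.
have E g s : ext (smul F H) g s = ext F g s * ext H g s.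
  by rewrite /ext; case: pselect => // _; rewrite mulr0.
rewrite /fold !E; have [u0|u0] := leP (2 * u - 1) 0.
  have out G g : ext G g (2 * u - 1) = 0 by apply: ext_out => /andP[]; lra.
  by rewrite !out mul0r !add0r.
have out G g : ext G g (1 - 2 * u) = 0 by apply: ext_out => /andP[]; lra.
by rewrite !out mul0r !addr0.
Qed.

Lemma foldJ F u : fold (star F) u = conjc (fold F u).
Proof.
have E g s : ext (star F) g s = conjc (ext F g s).
  by rewrite /ext; case: pselect => // _; rewrite conjc0.
by rewrite /fold !E rmorphD.
Qed.

Lemma fold_rtrans F u : fold (C0_rtrans flip F) u = fold F (1 - u).
Proof.
have E g s : ext (C0_rtrans flip F) g s = ext F (g * flip)%g s.
  by rewrite /ext; case: pselect.
rewrite /fold !E addrC; congr (ext F _ _ + ext F _ _); try ring.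
  exact: val_inj.
exact: val_inj.
Qed.

Lemma fold_id u : 0 <= u <= 1 ->
  fold (C0_tensor (unitIoc_id R) (C0_one R Z2)) u = `|2 * u - 1|%:C.
Proof.
move=> u01; have E g s : s <= 1 -> ext (C0_tensor (unitIoc_id R) (C0_one R Z2)) g s = (Num.max 0 s)%:C.
  move=> s1; rewrite /ext; case: pselect => /= [|s01].
    by move=> /andP[s0 _]; rewrite mulr1 max_r// ltW.
  by rewrite max_l// leNgt; apply/negP => s0; apply: s01; rewrite s0.
rewrite /fold !E; [|lra|lra].
rewrite -rmorphD; congr (_%:C); have [h|h] := leP 0 (2 * u - 1).
  by rewrite ger0_norm// max_l; lra.
by rewrite ltr0_norm// max_r; lra.
Qed.

End Folding.

(** * The upper bound *)

Lemma ucont_ext (R : realType) (f g : R -> R[i]) :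
  (forall s, 0 <= s <= 1 -> f s = g s) -> ucont f -> ucont g.
Proof.
move=> fg hf e /hf[C C0 fC]; exists C => // s t s01 t01.
by rewrite -!fg//; exact: fC.
Qed.

Section Representation.
Variables (R : realType) (A : unitalCstarType R) (A1 : sone != 0 :> A).
Local Notation T := (calg A1).
Implicit Types (x y : T) (F : C0 R (unitIoc R * Z2)%type).

Definition rho x F : A := fcalc x (fold F).

Lemma rho_star_hom x : pos x -> pos (1 - x) -> star_hom (rho x).
Proof.
move=> x0 x1; split=> [F H|c F|F H|F].
- rewrite /rho -[RHS](fcalcD x0 x1 (fold_ucont F) (fold_ucont H)).
  by apply: eq_fcalc => s _; exact: foldD.
- transitivity (c *: fcalc x (fold F) : T) => //.
  rewrite -(fcalcZ x0 x1 c (fold_ucont F)).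
  by apply: eq_fcalc => s _; exact: foldZ.
- rewrite /rho -[RHS](fcalcM x0 x1 (fold_ucont F) (fold_ucont H)).
  by apply: eq_fcalc => s _; exact: foldM.
- rewrite /rho -[RHS](fcalcJ x0 x1 (fold_ucont F)).
  by apply: eq_fcalc => s _; exact: foldJ.
Qed.

Lemma rho_flip (alpha : T -> T) x F : star_hom (alpha : A -> A) -> alpha 1 = 1 ->
  alpha x = 1 - x -> pos x -> pos (1 - x) ->
  rho x (C0_rtrans flip F) = alpha (rho x F).
Proof.
move=> ha a1 ax x0 x1.
rewrite /rho [RHS](fcalc_hom ha a1 x0 x1 (fold_ucont F)) ax fcalc_onem.
by apply: eq_fcalc => s _; exact: fold_rtrans.
Qed.

Definition rhot x : T := rho x (C0_tensor (unitIoc_id R) (C0_one R Z2)).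

Lemma ucont_abs : ucont (fun u : R => `|2 * u - 1|%:C).
Proof. by apply: ucont_ext (@fold_id R) _; exact: fold_ucont. Qed.

Lemma rhotE x : rhot x = fcalc x (fun u => `|2 * u - 1|%:C).
Proof. by apply: eq_fcalc => s; exact: fold_id. Qed.

Lemma half_mid y : (2%:R : R)%:C *: ((2^-1 : R)%:C *: (1 + y)) - 1 = y :> T.
Proof.
by rewrite scalerA -rmorphM/= divff ?pnatr_eq0// scale1r addrC addrA addNr add0r.
Qed.

Section Affine.
Variable y : T.
Hypotheses (sy : adj y = y) (y1 : nrm y <= 1).
Let x : T := (2^-1 : R)%:C *: (1 + y).

Let half0 : 0 <= 2^-1 :> R. Proof. by rewrite invr_ge0. Qed.

Lemma affine_pos : pos x.
Proof.
apply: posZ => //; have := @pos_sub _ _ A1 1 (- y).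
rewrite opprK scale1r; apply; [by rewrite adjN sy|by rewrite nrmN].
Qed.

Lemma affine_onem : 1 - x = (2^-1 : R)%:C *: (1 - y).
Proof.
rewrite -[1 in LHS](scale_half_add) /x -scalerBr opprD addrA.
by congr (_ *: _); rewrite addrK.
Qed.

Lemma affine_pos_onem : pos (1 - x).
Proof.
rewrite affine_onem; apply: posZ => //; have := pos_sub sy y1.
by rewrite scale1r.
Qed.

Lemma rhot_sqr : rhot x * rhot x = y * y.
Proof.
have [x0 x1] := (affine_pos, affine_pos_onem).
have hu : ucont (fun u : R => (2%:R)%:C * u%:C) by apply/ucontZ/ucont_id.
have yE : fcalc x (fun u => (2%:R)%:C * u%:C - 1) = y.
  rewrite fcalcB//; last exact: ucont_cst.
  rewrite fcalcZ//; last exact: ucont_id.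
  by rewrite fcalc_id fcalc_cst scale1r half_mid.
rewrite rhotE -fcalcM//; [|exact: ucont_abs|exact: ucont_abs].
rewrite -yE -fcalcM//; [|by apply: ucontB => //; exact: ucont_cst..].
apply: eq_fcalc => s _; rewrite -rmorphM/= -expr2 real_normK ?num_real//.
by rewrite rmorphXn rmorphB rmorphM.
Qed.

Lemma rhot_sub_sqr_pos : pos (rhot x - y * y).
Proof.
have [x0 x1] := (affine_pos, affine_pos_onem); have ua := ucont_abs.
rewrite -rhot_sqr rhotE -fcalcM// -fcalcB//; last exact: ucontM.
rewrite (_ : (fun s => _) = (fun s : R => (`|2 * s - 1| - `|2 * s - 1| * `|2 * s - 1|)%:C)).
  apply: (@fcalc_pos _ _ _ _ x0 x1 _ 1).
    apply: ucont_ext (ucontB ua (ucontM ua ua)) => s _.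
    by rewrite rmorphB rmorphM.
  move=> s s01; have n1 : `|2 * s - 1| <= 1 by rewrite ler_norml; lra.
  have := normr_ge0 (2 * s - 1); nra.
by apply/funext => s; rewrite rmorphB rmorphM.
Qed.

End Affine.

(** The scaling of [pos_sqrt] again: c + x = (t + c)(1 - w) with |w| <= t / (t + c) < 1. *)
Lemma pos_add_invertible c x : 0 < c -> pos x -> exists y : T,
  (c%:C%:A + x) * y = 1 /\ y * (c%:C%:A + x) = 1.
Proof.
move=> c0 [sx [t t0 tx]]; have tc : 0 < t + c by lra.
have ti : 0 <= (t + c)^-1 by rewrite invr_ge0 ltW.
pose w : T := (t + c)^-1%:C *: (t%:C%:A - x).
have [|||y [y1 y2]] := @one_sub_invertible _ _ A1 w (t / (t + c)).
- by rewrite adjZr adjB adjA sx.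
- by rewrite nrmZr ger0_norm// mulrC ler_wpM2r.
- by rewrite ltr_pdivrMr//; lra.
have E : c%:C%:A + x = (t + c)%:C *: (1 - w).
  rewrite scalerBr /w scalerA -rmorphM/= divff ?gt_eqF// scale1r opprB rmorphD scalerDl.
  by rewrite (addrC t%:C%:A) addrACA subrr addr0.
exists ((t + c)^-1%:C *: y); rewrite E -!scalerAl -!scalerAr y1 y2 !scalerA -!rmorphM/=.
by rewrite divff ?gt_eqF// mulVf ?gt_eqF// scale1r.
Qed.

Section Isometry.
Variable V : T.
Hypothesis VV : adj V * V = 1.

Definition reV : T := (2^-1 : R)%:C *: (V + adj V).
Definition imV : T := (2^-1 : R)%:C *: ('i%C *: (adj V - V)).

Lemma isometry_nrm : nrm V <= 1.
Proof.
have := nrm_adj_mul V; rewrite VV => h; have := nrm1_le1 A1; rewrite h.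
have := nrm_ge0 V; nra.
Qed.

Lemma reV_sa : adj reV = reV.
Proof. by rewrite adjZr adjD adjK addrC. Qed.

Lemma imV_sa : adj imV = imV.
Proof.
rewrite adjZr adjZ adjB adjK; congr (_ *: _).
have -> : conjc ('i%C : R[i]) = - 'i%C by apply/eqP; rewrite eq_complex/= oppr0 !eqxx.
by rewrite scaleNr -scalerN opprB.
Qed.

Lemma reV_nrm : nrm reV <= 1.
Proof.
have := isometry_nrm; have := nrmD V (adj V); rewrite nrm_adj nrmZr ger0_norm ?invr_ge0//; lra.
Qed.

Lemma imV_nrm : nrm imV <= 1.
Proof.
have := isometry_nrm; have := nrmB (adj V) V; rewrite nrm_adj nrmZr nrmZ ger0_norm ?invr_ge0//.
have -> : complex.Re `|('i%C : R[i])| = 1 by rewrite normc_def/= expr0n expr1n add0r sqrtr1.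
lra.
Qed.

Lemma reV_imV : reV * reV + imV * imV = (2^-1 : R)%:C%:A + (2^-1 : R)%:C *: (V * adj V).
Proof.
have i2 : ('i%C : R[i]) * 'i%C = -1 by rewrite -expr2 sqr_i.
have sM (p q : R[i]) x y : (p *: x) * (q *: y) = (p * q) *: (x * y).
  by rewrite -scalerAl -scalerAr scalerA.
rewrite /reV /imV !sM i2 -!scalerDr -scalerA; congr (_ *: _).
rewrite scaleN1r !mulrDl !mulrDr !mulNr !mulrN VV opprK.
set a := V * V; set b := V * adj V; set c := adj V * adj V.
have -> : a + b + (1 + c) - (c - 1 + (- b + a)) = (1 + b) + (1 + b).
  rewrite !opprD !opprK !addrA.
  by rewrite addrK addrC -!addrA addKr addrCA.
by rewrite scale_half_add.
Qed.

Lemma isometry_sum_invertible :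
  let x0 : T := (2^-1 : R)%:C *: (1 + reV) in
  let x1 : T := (2^-1 : R)%:C *: (1 + imV) in
  exists y, (rhot x0 + rhot x1) * y = 1 /\ y * (rhot x0 + rhot x1) = 1.
Proof.
move=> x0 x1.
have p0 := rhot_sub_sqr_pos reV_sa reV_nrm; have p1 := rhot_sub_sqr_pos imV_sa imV_nrm.
(* A self-adjoint idempotent is its own square. *)
have pV : pos (V * adj V).
  have sV : adj (V * adj V) = V * adj V by rewrite adjM adjK.
  have <- : (V * adj V) * (V * adj V) = V * adj V.
    by rewrite mulrA -(mulrA V) VV mulr1.
  exact: pos_sqr.
have h0 : 0 < 2^-1 :> R by rewrite invr_gt0.
have := pos_add_invertible h0 (posD (posD p0 p1) (posZ (ltW h0) pV)).
rewrite addrCA -reV_imV [X in X + _]addrACA.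
by rewrite -opprD subrK.
Qed.

End Isometry.
End Representation.

(** * The complex numbers as a C*-algebra *)

(** The target of the character. The universal property of the graph algebra applies to it only once
    it carries the C*-structure. *)
Definition cplx (R : realType) : Type := R[i]^o.
HB.instance Definition _ (R : realType) := NormedModule.copy (cplx R) R[i]^o.

Section ComplexCStar.
Variable R : realType.
Local Notation C := (cplx R).

Lemma cnorm_le_ReIm (z : R[i]) : cnorm z <= `|complex.Re z| + `|complex.Im z|.
Proof.
rewrite [in leLHS](complexE z); apply: (le_trans (cnormD _ _)).
rewrite cnormr cnormM (_ : cnorm 'i%C = 1) ?mul1r ?cnormr//.
by rewrite /cnorm normc_def/= expr0n expr1n add0r sqrtr1.
Qed.

Lemma cplx_complete (F : set_system C) : ProperFilter F -> cauchy F -> cvg F.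
Proof.
move=> FF Fc; have Fe e : 0 < e -> exists z : C, F [set w | cnorm ((z : R[i]) - w) < e].
  move=> e0; have eC : 0 < e%:C :> R[i] by rewrite (ltcR 0).
  have [z Fz] := proj1 (cauchyP F) Fc _ eC; exists z; apply: filterS Fz => w.
  by rewrite -ball_normE /= cnormE ltcR.
(* Real and imaginary parts are additive and 1-Lipschitz, which reduces completeness to that of the
   reals. *)
have part (h : R[i] -> R) : (forall z w, h (z - w) = h z - h w) ->
    (forall z, `|h z| <= cnorm z) -> exists a : R, h @ F --> a.
  move=> hB hle; have : cvg (h @ F).
    apply: cauchy_cvg; apply: cauchy_exP => e /Fe[z Fz]; exists (h z).
    change (F (h @^-1` ball (h z) e)); apply: filterS Fz => w /= zw; rewrite -ball_normE.
    change (`|h z - h w| < e); rewrite -hB.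
    exact: le_lt_trans (hle _) zw.
  by move=> /cvg_ex[a Fa]; exists a.
have [|a Fa] := part (@complex.Re R) _ (@Re_le_cnorm R); first by move=> [? ?] [? ?].
have [|b Fb] := part (@complex.Im R) _ (@Im_le_cnorm R); first by move=> [? ?] [? ?].
apply/cvg_ex; exists (a +i* b : C); apply/cvgrPdist_lt => e e0.
have eE : e = (complex.Re e)%:C by rewrite RRe_real// gtr0_real.
have e20 : 0 < complex.Re e / 2 by rewrite divr_gt0// -(ltcR 0) -eE.
have HR : F (fun z : C => `|a - complex.Re (z : R[i])| < complex.Re e / 2).
  exact: proj1 (cvgrPdist_lt _ _) Fa _ e20.
have HI : F (fun z : C => `|b - complex.Im (z : R[i])| < complex.Re e / 2).
  exact: proj1 (cvgrPdist_lt _ _) Fb _ e20.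
apply: (filterS _ (filterI HR HI)) => -[c d] /= [ac bd]; rewrite cnormE eE ltcR.
by apply: le_lt_trans (cnorm_le_ReIm _) _; rewrite /=; lra.
Qed.

HB.instance Definition _ := Uniform_isComplete.Build C cplx_complete.

Lemma cplx_scalerAl (c : R[i]) (x y : C) : ((c *: x : C) : R[i]) * y = c *: (x * y : R[i]^o).
Proof. exact: esym (mulrA _ _ _). Qed.

Lemma cplx_scalerAr (c : R[i]) (x y : C) : (x : R[i]) * (c *: y : C) = c *: (x * y : R[i]^o).
Proof. exact: mulrCA. Qed.

Lemma cplx_conjM (x y : R[i]) : conjc (x * y) = conjc y * conjc x.
Proof. by rewrite rmorphM mulrC. Qed.

HB.instance Definition _ := Lmodule_isStarAlgebra.Build R C
  (@mulrA R[i]) (@mulrDl R[i]) (@mulrDr R[i]) cplx_scalerAl cplx_scalerAr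
  (@conjcK R) (rmorphD (@conjc R)) (fun c x => rmorphM (@conjc R) c x) cplx_conjM.

Lemma cplx_norm_mul (x y : C) : `|smul x y| <= `|x| * `|y|.
Proof. by rewrite le_eqVlt (normrM (x : R[i]) y) eqxx. Qed.

Lemma cplx_norm_star (x : C) : `|smul (star x) x| = `|x| ^+ 2.
Proof.
transitivity (`|conjc (x : R[i]) * x|) => //.
by rewrite normrM cnormE cnormJ -cnormE expr2.
Qed.

HB.instance Definition _ := StarAlgebra_isCStar.Build R C cplx_norm_mul cplx_norm_star.
HB.instance Definition _ := StarAlgebra_hasUnit.Build R C (@mul1r R[i]) (@mulr1 R[i]).

Lemma cplx1_neq0 : (sone : C) != 0.
Proof. exact: oner_neq0 R[i]. Qed.

(** Vertices and edges are both booleans, so one function serves for P and S: v1 and its loop go to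
    1, v2 and the other edge to 0. Hence V goes to 1. *)
Definition trivial_proj (v : vertex toeplitz_graph) : C := (~~ v)%:R : R[i].

Lemma trivial_CK : CK_family trivial_proj (trivial_proj : edge toeplitz_graph -> C).
Proof.
have J v : star (trivial_proj v) = trivial_proj v by exact: conjc_nat.
have M v w : smul (trivial_proj v) (trivial_proj w) = trivial_proj (v || w).
  by case: v; case: w; rewrite /trivial_proj /=; [exact: mul0r|exact: mul0r|exact: mulr0|exact: mulr1].
split => /=.
- by move=> v; split; rewrite ?M ?J ?orbb.
- by case; case => // _; rewrite M.
- by move=> e; rewrite J !M !orbb.
- by case; case => // _; rewrite !J !M.
- by move=> e; rewrite J M orbb.
- move=> e; exists (trivial_proj (~~ e)); rewrite !J !M !orbb /trivial_proj negbK.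
  by case: e => /=; [exact: subr0|exact: subrr].
- move=> v [_ <-]; rewrite (eq_bigl xpredT) => [|e]; last by rewrite eqxx.
  by rewrite big_bool !J !M /= add0r.
Qed.

End ComplexCStar.

(** * The lower bound *)

(** The image of the unit is a unit for the range, which is everything because [alpha g] is
    invertible. *)
Lemma act_sone (G : topGroupType) (R : realType) (A : unitalCstarType R)
    (alpha : cstar_action G A) g : alpha g sone = sone.
Proof.
have e1 : alpha g (alpha g^-1 sone)%g = sone by rewrite -actM mulgV act1.
by rewrite -[LHS]smul1r -{2}e1 -(star_homM (act_hom alpha g)) smul1l e1.
Qed.

Lemma star_homN (R : realType) (A B : starAlgType R) (f : A -> B) x :
  star_hom f -> f (- x) = - f x.
Proof.
by move=> hf; apply: (addrI (f x)); rewrite -(star_homD hf) !subrr; exact: star_hom0.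
Qed.

Lemma Z2_circle_flip (R : realType) : \val (Z2_circle R flip) = -1.
Proof. by rewrite /Z2_circle expg1. Qed.

Lemma Z2_cases (g : Z2) : g = 1%g \/ g = flip.
Proof. by case: g => [[|[|//]] h]; [left|right]; exact: val_inj. Qed.

Section SignFunction.
Variable R : realType.

Lemma sign_subproof : (fun g : Z2 => (if g == flip then -1 else 1) : R[i]^o) \in in_C0 R Z2.
Proof.
have c : continuous (fun g : Z2 => (if g == flip then -1 else 1) : R[i]^o).
  move=> a U /nbhs_singleton Ua; apply: (@filterS _ (nbhs a) _ _ _ _ (discrete_set1 a)).
  by move=> x ->.
apply/mem_set; split=> // e e0.
by apply: (C0_le e0 c Z2_compact).
Qed.

Definition signZ2 : C0 R Z2 := MkC0 sign_subproof.

Definition tsign : C0 R (unitIoc R * Z2)%type := C0_tensor (unitIoc_id R) signZ2.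
Definition tone : C0 R (unitIoc R * Z2)%type := C0_tensor (unitIoc_id R) (C0_one R Z2).

Lemma tsign_star : star tsign = tsign.
Proof.
apply: C0_ext => -[s g].
have E : tsign (s, g) = (\val s * (if g == flip then -1 else 1))%:C.
  by rewrite /=; case: ifP => _; rewrite ?mulr1 ?mulrN1 ?rmorphN.
by transitivity (conjc (tsign (s, g))) => //; rewrite E; exact: conjc_real.
Qed.

Lemma tsign_sqr : smul tsign tsign = smul tone tone.
Proof.
apply: C0_ext => -[s g] /=; rewrite mulr1; case: ifP => _; last by rewrite mulr1.
by rewrite mulrN1 mulrNN.
Qed.

Lemma tsign_flip : C0_rtrans flip tsign = - tsign.
Proof.
apply: C0_ext => -[s g]; transitivity (- tsign (s, g)) => //.
have [->|->] := Z2_cases g; rewrite /= ?mulrN1 ?mulr1 ?opprK//.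
Qed.

End SignFunction.

Section CirclePath.
Variable R : realType.
Implicit Type a : R.

Lemma cis_subproof a : (cos a +i* sin a : R[i]^o) \in [set z : R[i]^o | `|z| = 1].
Proof. by apply/mem_set; rewrite /= normc_def/= cos2Dsin2 sqrtr1. Qed.

Definition cis a : circle R := exist _ (cos a +i* sin a) (cis_subproof a).

Lemma cis_continuous : continuous cis.
Proof.
apply: continuous_to_circle => a; apply/(@cvgrPdist_lt R[i]) => e e0.
have eE : e = (complex.Re e)%:C by rewrite RRe_real// gtr0_real.
have e20 : 0 < complex.Re e / 2 by rewrite divr_gt0// -(ltcR 0) -eE.
have Hc : nbhs a (fun t : R => `|cos a - cos t| < complex.Re e / 2).
  exact: proj1 (cvgrPdist_lt _ _) (@continuous_cos R a) _ e20.
have Hs : nbhs a (fun t : R => `|sin a - sin t| < complex.Re e / 2).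
  exact: proj1 (cvgrPdist_lt _ _) (@continuous_sin R a) _ e20.
apply: (filterS _ (filterI Hc Hs)) => t /= [hc hs]; rewrite cnormE eE ltcR.
by apply: le_lt_trans (cnorm_le_ReIm _) _; rewrite /=; lra.
Qed.

Lemma cis0 : cis 0 = 1%g.
Proof. by apply: val_inj; rewrite /= cos0 sin0. Qed.

Lemma cispi : cis pi = Z2_circle R flip.
Proof.
apply: val_inj; rewrite Z2_circle_flip /= cospi sinpi.
by apply/eqP; rewrite eq_complex /= oppr0 !eqxx.
Qed.

End CirclePath.

Section Toeplitz.
Variables (R : realType) (A : unitalCstarType R).
Variables (P : vertex toeplitz_graph -> A) (S : edge toeplitz_graph -> A).
Variable gamma : cstar_action (circle R) A.
Hypothesis A_graph : is_graph_algebra P S.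
Hypothesis gamma_gauge : is_gauge_action P S gamma.
Let alpha := Z2_restriction gamma.

Lemma toeplitz_character : exists2 chi : A -> cplx R, star_hom chi & chi sone = sone.
Proof.
have [chi [[hchi chiP _] _]] := A_graph.2 _ _ _ (trivial_CK R).
(* [P false] has image 1, so multiplicativity forces the image of the unit to be 1. *)
exists chi => //; have := star_homM hchi sone (P false).
rewrite smul1l chiP => e; rewrite [RHS]e; symmetry; exact: mulr1.
Qed.

Lemma toeplitz_nontrivial : sone != 0 :> A.
Proof.
have [chi hchi chi1] := toeplitz_character.
by apply/eqP => e; have := cplx1_neq0 R; rewrite -chi1 e (star_hom0 hchi) eqxx.
Qed.

Lemma toeplitz_no_witness0 : ~ exists rho, @WLT_witness R Z2 A alpha 0 rho.
Proof.
move=> [rho [rho_hom rho_eq]]; rewrite big_ord1 => -[b [ab ba]].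
set h := rho ord0 in ab ba; have hh : star_hom h := rho_hom ord0.
have A1 := toeplitz_nontrivial; have [chi hchi chi1] := toeplitz_character.
pose x := h (tsign R).
have xx : smul x x = smul (h (tone R)) (h (tone R)).
  by rewrite -!(star_homM hh) tsign_sqr.
have sx : star x = x by rewrite -(star_hom_star hh) tsign_star.
have xN : gamma (Z2_circle R flip) x = - x.
  transitivity (h (C0_rtrans flip (tsign R))); first by rewrite [RHS]rho_eq.
  by rewrite tsign_flip star_homN.
(* The path [cis] joins 1 to -1 in the circle, along which the Z/2-action extends to the gauge
   action. Continuity of [p] rests on [chi] being contractive. *)
pose p t : R[i] := chi (gamma (cis t) x).
have pJ t : conjc (p t) = p t.
  by rewrite -[LHS](star_hom_star hchi) -(star_hom_star (act_hom gamma _)) sx.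
have contr y : nrm (chi y) <= nrm y.
  by have := @star_hom_contractive R A (cplx R) A1 (cplx1_neq0 R) chi hchi chi1 y.
pose f t := complex.Re (p t).
have fc : continuous f.
  move=> t; apply/cvgrPdist_lt => e e0.
  have eC : 0 < e%:C :> R[i] by rewrite (ltcR 0).
  have gc : continuous (fun t : R => gamma (cis t) x).
    move=> u; apply: (@continuous_comp _ _ _ (@cis R) (fun z => gamma z x)).
      exact: cis_continuous.
    exact: act_continuous.
  have H : nbhs t (fun u : R => `|gamma (cis t) x - gamma (cis u) x| < e%:C).
    exact: proj1 (cvgrPdist_lt _ _) (gc t) _ eC.
  apply: (filterS _ H) => u; rewrite nrmE ltcR; apply: le_lt_trans.
  have := contr (gamma (cis t) x - gamma (cis u) x); apply: le_trans.
  rewrite (star_homD hchi) (star_homN _ hchi); apply: le_trans (Re_le_cnorm (p t - p u)).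
  by rewrite raddfB.
have fpi : f pi = - f 0.
  by rewrite /f /p cispi cis0 act1 xN (star_homN _ hchi); exact: raddfN.
have [|c _ fc0] := @IVT R f 0 pi 0 (pi_ge0 R) (continuous_subspaceT fc).
  rewrite fpi ge_min le_max oppr_le0 oppr_ge0 [in X in _ && X]orbC andbb.
  exact: le_total.
have pc : p c = 0.
  move: (pJ c) fc0; rewrite /f; case: (p c) => a d /= [dN] ->.
  by apply/eqP; rewrite eq_complex /= eqxx /= -eqNr dN.
(* The image of an invertible element under a unital homomorphism is nonzero, yet q^2 = p(c)^2 =
   0. *)
pose q : R[i] := chi (gamma (cis c) (h (tone R))).
have qq : q * q = p c * p c.
  rewrite -[LHS](star_homM hchi) -[RHS](star_homM hchi).
  by rewrite -!(star_homM (act_hom gamma _)) xx.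
have qb : q * chi (gamma (cis c) b) = 1 :> R[i].
  by rewrite -[LHS](star_homM hchi) -(star_homM (act_hom gamma _)) ab act_sone.
move/eqP: qq; rewrite pc mul0r mulf_eq0 orbb => /eqP q0.
by move: qb; rewrite q0 mul0r => /eqP; rewrite eq_sym oner_eq0.
Qed.

Lemma toeplitz_witness1 : exists rho, @WLT_witness R Z2 A alpha 1 rho.
Proof.
have A1 := toeplitz_nontrivial.
pose al : calg A1 -> calg A1 := gamma (Z2_circle R flip).
have hal : star_hom (al : A -> A) := act_hom gamma _.
have al1 : al 1 = 1 by exact: act_sone.
have alZ (c : R[i]) (y : calg A1) : al (c *: y) = c *: al y by exact: star_homZ hal c y.
have alD (y z : calg A1) : al (y + z) = al y + al z := star_homD hal y z.
have alN (y : calg A1) : al (- y) = - al y by exact: (star_homN y hal).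
have alJ (y : calg A1) : al (adj y) = adj (al y) := star_hom_star hal y.
have alS e : al (S e) = - S e.
  rewrite /al gamma_gauge.1 Z2_circle_flip; exact: scaleN1r.
have [V VV alV] : exists2 V : calg A1, adj V * V = 1 & al V = - V.
  exists (S false + S true : A); first by have [] := toeplitz_graph_isometry A_graph.
  by rewrite alD !alS -opprD.
pose x0 : calg A1 := (2^-1 : R)%:C *: (1 + reV V).
pose x1 : calg A1 := (2^-1 : R)%:C *: (1 + imV V).
have onem y : 1 - (2^-1 : R)%:C *: (1 + y) = (2^-1 : R)%:C *: (1 - y) :> calg A1.
  exact: affine_onem.
have ax0 : al x0 = 1 - x0.
  by rewrite onem /x0 /reV !(alZ, alD) alJ al1 alV adjN -opprD scalerN.
have ax1 : al x1 = 1 - x1.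
  by rewrite onem /x1 /imV !(alZ, alD, alN) alJ al1 alV adjN -opprD !scalerN.
have [p0 p0'] : pos x0 /\ pos (1 - x0).
  by split; [apply: affine_pos|apply: affine_pos_onem]; rewrite ?reV_sa ?reV_nrm.
have [p1 p1'] : pos x1 /\ pos (1 - x1).
  by split; [apply: affine_pos|apply: affine_pos_onem]; rewrite ?imV_sa ?imV_nrm.
pose X (i : 'I_2) : calg A1 := if i == ord0 then x0 else x1.
have Xp i : pos (X i) by rewrite /X; case: ifP.
have Xp' i : pos (1 - X i) by rewrite /X; case: ifP.
have aX i : al (X i) = 1 - X i by rewrite /X; case: ifP.
exists (fun i => rho (X i)); split.
- by move=> i; exact: rho_star_hom.
- move=> i g F; have [->|->] := Z2_cases g.
    by rewrite act1; congr rho; apply: C0_ext => -[s h]; rewrite /= mulg1.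
  exact: (rho_flip F hal al1 (aX i) (Xp i) (Xp' i)).
- have [y [y1 y2]] := isometry_sum_invertible VV.
  exists y; rewrite big_ord_recl big_ord1.
  by split; [exact: y1|exact: y2].
Qed.

End Toeplitz.

Theorem proposition5p10 (R : realType) (T : unitalCstarType R)
    (P : vertex toeplitz_graph -> T) (S : edge toeplitz_graph -> T)
    (gamma : cstar_action (circle R) T)
    (T_graph : is_graph_algebra P S)
    (gamma_gauge : is_gauge_action P S gamma) :
  dim_WLT (Z2_restriction gamma) = Some 1%N.
Proof.
have w1 := toeplitz_witness1 T_graph gamma_gauge.
have w0 := toeplitz_no_witness0 T_graph.
rewrite /dim_WLT; case: pselect => [h|[]]; last by exists 1%N; apply/asboolP.
case: ex_minnP => m /asboolP wm /(_ 1%N) m1; congr Some.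
case: m wm m1 => [/w0//|[//|m] _ m1].
by have := m1 (asboolT w1).
Qed.
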